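(* Let $G$ be a four-dimensional Lie group with a left-invariant Lorentzian metric which is a pp-wave. Then the metric is a plane wave if and only if its curvature is harmonic.
   Context: A Lorentzian manifold $(M,g)$ is a pp-wave if it admits a parallel degenerate (null) line field $\mathcal U$ that is locally generated by a parallel null vector field and $(M,g)$ is transversally flat, i.e. its curvature tensor satisfies $R(X,Y)=0$ for all $X,Y\in\mathcal U^\perp$. A pp-wave $(M,g,\mathcal U)$ is a plane wave if moreover $\nabla_XR=0$ for all $X\in\mathcal U^\perp$. The curvature is harmonic if $\operatorname{div}R=0$, equivalently the Ricci tensor $\rho$ is Codazzi: $(\nabla_X\rho)(Y,Z)=(\nabla_Y\rho)(X,Z)$ for all $X,Y,Z$. *)

(* Defs.v *)
(* The real numbers are an arbitrary R : realType. *)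
From HB Require Import structures.
From mathcomp Require Import all_boot all_order all_algebra.
From mathcomp Require Import all_classical all_reals all_analysis.
Set Implicit Arguments.
Unset Strict Implicit.
Unset Printing Implicit Defensive.
Import Order.TTheory GRing.Theory Num.Theory.
Import numFieldNormedType.Exports.
Local Open Scope classical_set_scope.
Local Open Scope ring_scope.

(** * Smooth maps between open subsets of finite-dimensional normed spaces *)

(* Meaningful for A open and V finite-dimensional, where it is the usual C^k. *)
Fixpoint Ck (R : realType) (V W : normedModType R) (k : nat) (A : set V)
    (f : V -> W) : Prop :=
  match k with
  | 0 => forall x, A x -> {for x, continuous f}
  | k'.+1 => (forall x, A x -> differentiable f x) /\
             (forall v, Ck k' A ('D_v f))
  end.

Definition smooth_on (R : realType) (V W : normedModType R) (A : set V)
    (f : V -> W) : Prop := forall k, Ck k A f.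

(** * Smooth manifolds *)

(* fwd and bwd are total functions, relevant only on dom and img. *)
Record chart (R : realType) (n : nat) (M : topologicalType) := Chart {
  dom : set M;
  img : set 'rV[R]_n;
  fwd : M -> 'rV[R]_n;
  bwd : 'rV[R]_n -> M;
  dom_open : open dom;
  img_open : open img;
  fwd_img : forall p, dom p -> img (fwd p);
  bwd_dom : forall x, img x -> dom (bwd x);
  fwdK : forall p, dom p -> bwd (fwd p) = p;
  bwdK : forall x, img x -> fwd (bwd x) = x;
  fwd_continuous : forall p, dom p -> {for p, continuous fwd};
  bwd_continuous : forall x, img x -> {for x, continuous bwd} }.

(* A structure of smooth n-dimensional manifold on M, given by an atlas. *)
Record smooth_structure (R : realType) (n : nat) (M : topologicalType) :=
  SmoothStructure {
  idx : Type;
  chart_of :> idx -> chart R n M;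
  smooth_hausdorff : hausdorff_space M;
  smooth_countable : @second_countable M;
  chart_cover : forall p, exists i, dom (chart_of i) p;
  smooth_transition : forall i j,
    smooth_on [set x | img (chart_of i) x /\
                       dom (chart_of j) (bwd (chart_of i) x)]
      (fun x => fwd (chart_of j) (bwd (chart_of i) x)) }.

Definition transition (R : realType) (n : nat) (M : topologicalType)
    (A : smooth_structure R n M) (i j : idx A) (x : 'rV[R]_n) : 'rV[R]_n :=
  fwd (A j) (bwd (A i) x).

(** * Lie groups *)

HB.structure Definition GroupTopological := {G of Group G & Topological G}.
Notation groupTopologicalType := GroupTopological.type.

Definition left_mul (G : groupTopologicalType) (a x : G) : G := (a * x)%g.

(* The smooth structure A makes G a Lie group. *)
Record lie_group (R : realType) (n : nat) (G : groupTopologicalType)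
    (A : smooth_structure R n G) : Prop := LieGroup {
  mul_continuous : continuous (fun ab : G * G => (ab.1 * ab.2)%g);
  inv_continuous : continuous (fun a : G => (a^-1)%g);
  mul_smooth : forall i j k : idx A,
    smooth_on
      [set xy : 'rV[R]_n * 'rV[R]_n | [/\ img (A i) xy.1, img (A j) xy.2 &
        dom (A k) (bwd (A i) xy.1 * bwd (A j) xy.2)%g]]
      (fun xy => fwd (A k) (bwd (A i) xy.1 * bwd (A j) xy.2)%g);
  inv_smooth : forall i j : idx A,
    smooth_on [set x | img (A i) x /\ dom (A j) ((bwd (A i) x)^-1)%g]
      (fun x => fwd (A j) ((bwd (A i) x)^-1)%g) }.

(** * Lorentzian metrics *)

(* A bilinear form is identified with its Gram matrix in the standard basis. *)
Definition bform (R : realType) (n : nat) (S : 'M[R]_n) (u v : 'rV[R]_n) : R :=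
  (u *m S *m v^T) 0 0.

Definition lorentzian_form (R : realType) (n : nat) (S : 'M[R]_n) : Prop :=
  exists2 P : 'M[R]_n, P \in unitmx &
    P *m S *m P^T =
    diag_mx (\row_(j < n) (if j == 0%N :> nat then -1 else 1)).

(* A tensor field is given by its components in every chart, subject to the
   transformation law under changes of charts; g i x is the Gram matrix of the
   metric at bwd (A i) x in the coordinate frame of the chart i. *)
Record lorentzian_metric (R : realType) (n : nat) (M : topologicalType)
    (A : smooth_structure R n M) := LorentzianMetric {
  metric_comp :> idx A -> 'rV[R]_n -> 'M[R]_n;
  metric_smooth : forall i, smooth_on (img (A i)) (metric_comp i);
  metric_sym : forall i x, img (A i) x -> (metric_comp i x)^T = metric_comp i x;
  metric_lorentzian : forall i x, img (A i) x ->
    lorentzian_form (metric_comp i x);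
  metric_transition : forall i j x, img (A i) x -> dom (A j) (bwd (A i) x) ->
    forall u v, bform (metric_comp j (transition i j x))
                  ('d (transition i j) x u) ('d (transition i j) x v) =
                bform (metric_comp i x) u v }.

Definition left_invariant (R : realType) (n : nat) (G : groupTopologicalType)
    (A : smooth_structure R n G) (g : lorentzian_metric A) : Prop :=
  forall (a : G) (i j : idx A) (x : 'rV[R]_n),
    img (A i) x -> dom (A j) (left_mul a (bwd (A i) x)) ->
    let La := fun y => fwd (A j) (left_mul a (bwd (A i) y)) in
    forall u v, bform (g j (La x)) ('d La x u) ('d La x v) =
                bform (g i x) u v.

(** * Levi-Civita connection and curvature in a chart *)

(* Below S is the metric in a chart and u, v, w, z are coordinate (constant)
   vector fields, so that their Lie brackets vanish. *)
Section LocalGeometry.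
Context (R : realType) (n : nat) (S : 'rV[R]_n -> 'M[R]_n).
Implicit Types x u v w z : 'rV[R]_n.

(* Koszul formula for the inner product of nabla_u v with w. *)
Definition koszul x u v w : R :=
  2^-1 * ('D_u (fun y => bform (S y) v w) x
          + 'D_v (fun y => bform (S y) u w) x
          - 'D_w (fun y => bform (S y) u v) x).

Definition christoffel x u v : 'rV[R]_n :=
  (\row_k koszul x u v (delta_mx 0 k)) *m invmx (S x).

(* Covariant derivative of a vector field X in the direction u. *)
Definition nabla (X : 'rV[R]_n -> 'rV[R]_n) x u : 'rV[R]_n :=
  'D_u X x + christoffel x u (X x).

(* R(u, v) w = nabla_u nabla_v w - nabla_v nabla_u w. *)
Definition curvature x u v w : 'rV[R]_n :=
  nabla (fun y => christoffel y v w) x u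
  - nabla (fun y => christoffel y u w) x v.

(* (nabla_z R)(u, v) w. *)
Definition nabla_curvature x z u v w : 'rV[R]_n :=
  nabla (fun y => curvature y u v w) x z
  - curvature x (christoffel x z u) v w
  - curvature x u (christoffel x z v) w
  - curvature x u v (christoffel x z w).

(* (div R)(u, v) w, the trace of z |-> (nabla_z R)(u, v) w. *)
Definition div_curvature x u v w : R :=
  \sum_k (nabla_curvature x (delta_mx 0 k) u v w) 0 k.

End LocalGeometry.

(** * pp-waves, plane waves, harmonic curvature *)

Section Waves.
Context (R : realType) (n : nat) (M : topologicalType).
Context (A : smooth_structure R n M) (g : lorentzian_metric A).

(* A field of lines in the tangent spaces; smoothness is stated separately. *)
Definition line_distribution (U : idx A -> 'rV[R]_n -> {vspace 'rV[R]_n}) :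
    Prop :=
  (forall i x, img (A i) x -> \dim (U i x) = 1%N) /\
  (forall i j x, img (A i) x -> dom (A j) (bwd (A i) x) ->
     forall v, v \in U i x -> 'd (transition i j) x v \in U j (transition i j x)).

(* X is, in the chart i, a smooth section of U over the open set O. *)
Definition local_section (U : idx A -> 'rV[R]_n -> {vspace 'rV[R]_n}) (i : idx A)
    (O : set 'rV[R]_n) (X : 'rV[R]_n -> 'rV[R]_n) : Prop :=
  [/\ open O, O `<=` img (A i), smooth_on O X &
      forall y, O y -> X y \in U i y].

Definition smooth_distribution (U : idx A -> 'rV[R]_n -> {vspace 'rV[R]_n}) :
    Prop :=
  forall i x, img (A i) x -> exists O X,
    [/\ local_section U i O X, O x & forall y, O y -> X y != 0].

Definition null_distribution (U : idx A -> 'rV[R]_n -> {vspace 'rV[R]_n}) :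
    Prop :=
  forall i x, img (A i) x -> forall v, v \in U i x -> bform (g i x) v v = 0.

Definition parallel_distribution (U : idx A -> 'rV[R]_n -> {vspace 'rV[R]_n}) :
    Prop :=
  forall i O X, local_section U i O X ->
    forall y, O y -> forall u, nabla (g i) X y u \in U i y.

Definition parallel_null_generated
    (U : idx A -> 'rV[R]_n -> {vspace 'rV[R]_n}) : Prop :=
  forall i x, img (A i) x -> exists O X,
    [/\ local_section U i O X, O x &
        forall y, O y ->
          [/\ X y != 0, bform (g i y) (X y) (X y) = 0 &
              forall u, nabla (g i) X y u = 0]].

(* v lies in the orthogonal complement of U at the point x of the chart i. *)
Definition orthogonal_to (U : idx A -> 'rV[R]_n -> {vspace 'rV[R]_n}) (i : idx A)
    (x v : 'rV[R]_n) : Prop :=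
  forall w, w \in U i x -> bform (g i x) w v = 0.

Definition transversally_flat (U : idx A -> 'rV[R]_n -> {vspace 'rV[R]_n}) :
    Prop :=
  forall i x, img (A i) x -> forall u v,
    orthogonal_to U i x u -> orthogonal_to U i x v ->
    forall w, curvature (g i) x u v w = 0.

Record pp_wave_along (U : idx A -> 'rV[R]_n -> {vspace 'rV[R]_n}) : Prop :=
  PpWaveAlong {
  pp_line : line_distribution U;
  pp_smooth : smooth_distribution U;
  pp_null : null_distribution U;
  pp_parallel : parallel_distribution U;
  pp_generated : parallel_null_generated U;
  pp_flat : transversally_flat U }.

Definition plane_wave_along (U : idx A -> 'rV[R]_n -> {vspace 'rV[R]_n}) :
    Prop :=
  pp_wave_along U /\
  forall i x, img (A i) x -> forall z, orthogonal_to U i x z ->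
    forall u v w, nabla_curvature (g i) x z u v w = 0.

Definition pp_wave : Prop := exists U, pp_wave_along U.

Definition plane_wave : Prop := exists U, plane_wave_along U.

Definition harmonic_curvature : Prop :=
  forall i x, img (A i) x -> forall u v w, div_curvature (g i) x u v w = 0.

End Waves.

(* Main.v *)
(** In a left-invariant coframe the metric, the connection and the curvature
    have constant components, so the theorem becomes a statement about the
    product [a.b] of the Levi-Civita connection on the Lie algebra.  If [R <> 0],
    the null vectors annihilated by [R] form a line, so the parallel null field
    has a constant direction [nu] in the coframe: [nu] is recurrent with some
    1-form [om], i.e. [z.nu = om(z) nu].  Complete [nu] to a null frame
    [nu, e1, e2, mu]; let [th(z) = <z.e1, e2>] be the rotation rate and [h] the
    symmetric 2x2 matrix [h_ij = <R(mu, e_i) mu, e_j>].  Then [nabla_z R] is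
    determined by [T(z) = 2 om(z) h + th(z) [J, h]], with [J] the rotation by a
    right angle, and plane means [T(e1) = T(e2) = 0], whereas harmonic means
    [sum_i T(e_i)_ij = 0].  The second Bianchi identity gives [T(nu) = 0] and
    [T(e1)_2j = T(e2)_1j], and with harmonicity it makes the [T(e_i)] trace free,
    so [om(e_i) tr h = 0].  If [tr h <> 0], then [om(e_i) = 0] and the equations
    force [th(e_i) = 0] or [h] scalar.  If [tr h = 0] and [h <> 0], then
    [T(nu) = 0] gives [th(nu) = 0]; since [R(e1, e2) = 0] makes
    [th(e1)^2 + th(e2)^2] a multiple of [th(nu)], [th] vanishes on the [e_i],
    and then so does [om]. *)
Require Import Defs.
From HB Require Import structures.
From mathcomp Require Import all_boot all_order all_algebra.
From mathcomp Require Import all_classical all_reals all_analysis.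
From mathcomp Require Import ring lra.
Set Implicit Arguments.
Unset Strict Implicit.
Unset Printing Implicit Defensive.
Import Order.TTheory GRing.Theory Num.Theory.
Import numFieldNormedType.Exports.
Local Open Scope classical_set_scope.
Local Open Scope ring_scope.

(** * Calculus of matrix-valued maps *)

Section DifferentiableMatrix.
Context (R : realType) (V : normedModType R).

Lemma differentiable_mxP m n (M : V -> 'M[R]_(m, n)) x :
  differentiable M x <-> forall i j, differentiable (fun y => M y i j) x.
Proof.
split=> [dM i j|dM].
  by apply: (@differentiable_comp _ _ _ _ M (fun N : 'M[R]_(m, n) => N i j)) => //;
    exact: differentiable_coord.
have -> : M = \sum_(i < m) \sum_(j < n) (fun y => M y i j *: delta_mx i j).
  apply/funext => y; rewrite fct_sumE [LHS]matrix_sum_delta.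
  by apply: eq_bigr => i _; rewrite fct_sumE.
apply: differentiable_sum => i; apply: differentiable_sum => j.
exact: differentiableZl.
Qed.

Lemma continuous_mxP m n (M : V -> 'M[R]_(m, n)) x :
  {for x, continuous M} <-> forall i j, {for x, continuous (fun y => M y i j)}.
Proof.
split=> [cM i j|cM].
  by apply: (@continuous_comp _ _ _ M (fun N : 'M[R]_(m, n) => N i j)) => //;
    exact: coord_continuous.
move=> B [P PM PB].
have : \forall y \near x, forall i j, P i j (M y i j).
  apply: filter_forall => i; apply: filter_forall => j.
  exact: cM (PM i j).
by apply: filterS => y Py; exact: PB.
Qed.

Lemma derive_mxE m n (M : V -> 'M[R]_(m, n)) x v i j :
  derivable M x v -> 'D_v M x i j = 'D_v (fun y => M y i j) x.
Proof. by move=> dM; rewrite derive_mx // mxE. Qed.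

Let derivable_mul (f g : V -> R) x v :
  derivable f x v -> derivable g x v -> derivable (fun y => f y * g y) x v.
Proof. exact: derivableM. Qed.

Let derive_mul (f g : V -> R) x v : derivable f x v -> derivable g x v ->
  'D_v (fun y => f y * g y) x = 'D_v f x * g x + f x * 'D_v g x.
Proof.
move=> df dg; rewrite (deriveM df dg) addrC.
by congr (_ + _); rewrite [LHS]mulrC.
Qed.

Let derivable_scalel (W : normedModType R) (f : V -> R) (w : W) x v :
  derivable f x v -> derivable (fun y => f y *: w) x v.
Proof.
move=> /cvg_ex[/= l fl]; apply/cvg_ex; exists (l *: w).
rewrite (_ : (fun _ => _) = fun h => (h^-1 *: (f (h *: v + x) - f x)) *: w).
  exact: cvgZr_tmp.
by apply/funext => h /=; rewrite -scalerBl scalerA.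
Qed.

Let derive_scalel (W : normedModType R) (f : V -> R) (w : W) x v :
  derivable f x v -> 'D_v (fun y => f y *: w) x = 'D_v f x *: w.
Proof.
move=> df; apply/cvg_lim => //=.
rewrite (_ : (fun _ => _) = fun h => (h^-1 *: (f (h *: v + x) - f x)) *: w).
  exact: cvgZr_tmp.
by apply/funext => h /=; rewrite -scalerBl scalerA.
Qed.

Let is_derive_fsum (W : normedModType R) (I : Type) (r : seq I)
    (h : I -> V -> W) x v : (forall i, derivable (h i) x v) ->
  is_derive x v (fun y => \sum_(i <- r) h i y) (\sum_(i <- r) 'D_v (h i) x).
Proof.
move=> dh; elim: r => [|i r IHr].
  by under eq_fun do rewrite big_nil; rewrite big_nil; exact: is_derive_cst.
under eq_fun do rewrite big_cons; rewrite big_cons.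
have dhi : is_derive x v (h i) ('D_v (h i) x) by exact: DeriveDef.
exact: is_deriveD.
Qed.

Let derivable_fsum (W : normedModType R) (I : Type) (r : seq I)
    (h : I -> V -> W) x v : (forall i, derivable (h i) x v) ->
  derivable (fun y => \sum_(i <- r) h i y) x v.
Proof. by move=> dh; have [] := is_derive_fsum r dh. Qed.

Let derive_fsum (W : normedModType R) (I : Type) (r : seq I)
    (h : I -> V -> W) x v : (forall i, derivable (h i) x v) ->
  'D_v (fun y => \sum_(i <- r) h i y) x = \sum_(i <- r) 'D_v (h i) x.
Proof. by move=> dh; have [] := is_derive_fsum r dh. Qed.

Lemma derivable_mulmx m n p (M : V -> 'M[R]_(m, n)) (N : V -> 'M[R]_(n, p)) x v :
  derivable M x v -> derivable N x v -> derivable (fun y => M y *m N y) x v.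
Proof.
move=> /derivable_mxP dM /derivable_mxP dN; apply/derivable_mxP => i j.
under eq_fun do rewrite mxE.
by apply: derivable_fsum => k; exact: derivable_mul.
Qed.

Lemma derive_mulmx m n p (M : V -> 'M[R]_(m, n)) (N : V -> 'M[R]_(n, p)) x v :
  derivable M x v -> derivable N x v ->
  'D_v (fun y => M y *m N y) x = 'D_v M x *m N x + M x *m 'D_v N x.
Proof.
move=> dM dN; have dMN := derivable_mulmx dM dN.
have /derivable_mxP dM' := dM; have /derivable_mxP dN' := dN.
apply/matrixP => i j; rewrite derive_mxE //.
under eq_fun do rewrite mxE.
rewrite derive_fsum; last by move=> k; exact: derivable_mul.
rewrite !mxE -big_split /=; apply: eq_bigr => k _.
by rewrite derive_mul // !derive_mxE.
Qed.

Lemma derivable_mulmxl m n p (C : 'M[R]_(m, n)) (N : V -> 'M[R]_(n, p)) x v :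
  derivable N x v -> derivable (fun y => C *m N y) x v.
Proof. by move=> dN; apply: derivable_mulmx => //; exact: derivable_cst. Qed.

Lemma derive_mulmxl m n p (C : 'M[R]_(m, n)) (N : V -> 'M[R]_(n, p)) x v :
  derivable N x v -> 'D_v (fun y => C *m N y) x = C *m 'D_v N x.
Proof.
by move=> dN; rewrite derive_mulmx // ?derive_cst ?mul0mx ?add0r //;
  exact: derivable_cst.
Qed.

Lemma derivable_mulmxr m n p (N : V -> 'M[R]_(m, n)) (C : 'M[R]_(n, p)) x v :
  derivable N x v -> derivable (fun y => N y *m C) x v.
Proof. by move=> dN; apply: derivable_mulmx => //; exact: derivable_cst. Qed.

Lemma derive_mulmxr m n p (N : V -> 'M[R]_(m, n)) (C : 'M[R]_(n, p)) x v :
  derivable N x v -> 'D_v (fun y => N y *m C) x = 'D_v N x *m C.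
Proof.
by move=> dN; rewrite derive_mulmx // ?derive_cst ?mulmx0 ?addr0 //;
  exact: derivable_cst.
Qed.

(** Expanding [M y] on the matrix units writes [f (M y)] as a finite sum of scalar functions times
    constant matrices. *)
Let is_derive_linear m n p q (f : {linear 'M[R]_(m, n) -> 'M[R]_(p, q)})
    (M : V -> 'M[R]_(m, n)) x v :
  derivable M x v -> is_derive x v (fun y => f (M y)) (f ('D_v M x)).
Proof.
move=> dM; have /derivable_mxP dM' := dM.
have fE N : f N = \sum_i \sum_j N i j *: f (delta_mx i j).
  rewrite [in LHS](matrix_sum_delta N) linear_sum.
  by apply: eq_bigr => i _; rewrite linear_sum; apply: eq_bigr => j _; rewrite linearZ.
have ds i j : derivable (fun y => M y i j *: f (delta_mx i j)) x v.
  exact: derivable_scalel.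
have di i : derivable (fun y => \sum_j M y i j *: f (delta_mx i j)) x v.
  exact: derivable_fsum.
under eq_fun do rewrite fE.
apply: DeriveDef; first exact: derivable_fsum.
rewrite derive_fsum // fE; apply: eq_bigr => i _.
rewrite derive_fsum //; apply: eq_bigr => j _.
by rewrite derive_scalel // derive_mxE.
Qed.

Lemma derivable_linear m n p q (f : {linear 'M[R]_(m, n) -> 'M[R]_(p, q)})
    (M : V -> 'M[R]_(m, n)) x v :
  derivable M x v -> derivable (fun y => f (M y)) x v.
Proof. by move=> dM; have [] := is_derive_linear f dM. Qed.

Lemma derive_linear m n p q (f : {linear 'M[R]_(m, n) -> 'M[R]_(p, q)})
    (M : V -> 'M[R]_(m, n)) x v :
  derivable M x v -> 'D_v (fun y => f (M y)) x = f ('D_v M x).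
Proof. by move=> dM; have [] := is_derive_linear f dM. Qed.

Lemma derivable_trmx m n (M : V -> 'M[R]_(m, n)) x v :
  derivable M x v -> derivable (fun y => (M y)^T) x v.
Proof.
move=> /derivable_mxP dM; apply/derivable_mxP => i j.
by under eq_fun do rewrite mxE; exact: dM.
Qed.

Lemma derive_trmx m n (M : V -> 'M[R]_(m, n)) x v :
  derivable M x v -> 'D_v (fun y => (M y)^T) x = ('D_v M x)^T.
Proof.
move=> dM; have dMT := derivable_trmx dM; apply/matrixP => i j.
rewrite derive_mxE // mxE derive_mxE //.
by congr ('D_v _ x); apply/funext => y; rewrite mxE.
Qed.

Lemma derive_comp (W : normedModType R) (W' : normedModType R)
    (f : V -> W) (g : W -> W') x v :
  differentiable f x -> differentiable g (f x) ->
  'D_v (fun y => g (f y)) x = 'D_('D_v f x) g (f x).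
Proof.
move=> df dg; rewrite -/(g \o f) [LHS]deriveE; last exact: differentiable_comp.
by rewrite diff_comp //= -!deriveE.
Qed.

End DifferentiableMatrix.

(** * Maps of class C^k: closure properties and symmetry of second derivatives *)

Section Ck.
Context (R : realType).
Implicit Types V W : normedModType R.

Lemma near_open (T : topologicalType) (A : set T) (P : T -> Prop) x :
  open A -> A x -> (forall y, A y -> P y) -> \near x, P x.
Proof. by move=> oA Ax AP; apply: filterS AP _; exact: open_nbhs_nbhs. Qed.

(** The first-order expansion at [x] depends only on the germ, so the differential of [f] also
    serves for [g]. *)
Lemma differentiable_near_eq V W (f g : V -> W) x :
  (\near x, f x = g x) -> differentiable f x -> differentiable g x.
Proof.
move=> fg df; have fxg : f x = g x := nbhs_singleton fg.
have /diff_locallyP[dc dE] := df.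
have gE : g \o shift x = cst (g x) + 'd f x +o_ (0 : V) id.
  apply/eqaddoP => e e0; have /eqaddoP/(_ e e0) := dE.
  have : \forall h \near (0 : V), f (h + x) = g (h + x).
    by move: fg; rewrite (near_shift 0); apply: filterS => h /=; rewrite subr0.
  apply: filterS2 => h fgh.
  by rewrite /= -![(_ + _ : V -> W) _]/(_ + _) -![(- _ : V -> W) _]/(- _) /= fgh -fxg.
have dgE : 'd g x = 'd f x :> (V -> W) by exact: diff_unique.
by apply/diff_locallyP; rewrite dgE.
Qed.

(** This allows a derivative to be replaced by a formula that holds only on the open set [A], as
    every induction on [k] below does. *)
Lemma Ck_eq V W k (A : set V) (f g : V -> W) :
  open A -> (forall x, A x -> f x = g x) -> Ck k A f -> Ck k A g.
Proof.
move=> oA; elim: k f g => [|k IHk] f g fg /=.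
  move=> cf x Ax B; rewrite -fg // => /(cf x Ax).
  rewrite /= !nbhs_simpl /= => fB.
  have : \near x, f x = g x by exact: near_open fg.
  by apply: filterS2 fB => y By fgy; rewrite /= -fgy.
move=> [df Df]; split=> [x Ax|v].
  by apply: differentiable_near_eq (df _ Ax); exact: near_open fg.
apply: IHk (Df v) => x Ax; apply: near_eq_derive; exact: near_open fg.
Qed.

Lemma Ck_subset V W k (A B : set V) (f : V -> W) :
  B `<=` A -> Ck k A f -> Ck k B f.
Proof.
move=> BA; elim: k f => [|k IHk] f /=; first by move=> cf x /BA /cf.
by move=> [df Df]; split=> [x /BA /df//|v]; exact: IHk.
Qed.

Lemma CkW V W k (A : set V) (f : V -> W) : Ck k.+1 A f -> Ck k A f.
Proof.
elim: k f => [|k IHk] f.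
  by move=> [df _] x Ax; exact: differentiable_continuous (df x Ax).
by move=> [df Df]; split => // v; apply: IHk; exact: Df.
Qed.

Lemma Ck_cst V W k (A : set V) (c : W) : Ck k A (fun=> c).
Proof.
elim: k c => [|k IHk] c; first by move=> x _; exact: cst_continuous.
split=> [x _|v]; first exact: differentiable_cst.
by rewrite (_ : 'D_v _ = fun=> 0) //; apply/funext => x; exact: derive_cst.
Qed.

Lemma CkD V W k (A : set V) (f g : V -> W) : open A ->
  Ck k A f -> Ck k A g -> Ck k A (fun x => f x + g x).
Proof.
move=> oA; elim: k f g => [|k IHk] f g.
  by move=> cf cg x Ax; exact: continuousD (cf x Ax) (cg x Ax).
move=> [df Df] [dg Dg]; split=> [x Ax|v].
  exact: differentiableD (df x Ax) (dg x Ax).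
apply: Ck_eq (IHk _ _ (Df v) (Dg v)) => // x Ax; apply/esym.
by apply: deriveD; apply: diff_derivable; [exact: df|exact: dg].
Qed.

Lemma Ck_sum V W k (A : set V) (I : Type) (r : seq I) (f : I -> V -> W) : open A ->
  (forall i, Ck k A (f i)) -> Ck k A (fun x => \sum_(i <- r) f i x).
Proof.
move=> oA Cf; elim: r => [|i r IHr].
  by under eq_fun do rewrite big_nil; exact: Ck_cst.
by under eq_fun do rewrite big_cons; apply: CkD.
Qed.

Lemma CkM V k (A : set V) (f g : V -> R) : open A ->
  Ck k A f -> Ck k A g -> Ck k A (fun x => f x * g x).
Proof.
move=> oA; elim: k f g => [|k IHk] f g Cf Cg.
  by move=> x Ax; exact: continuousM (Cf x Ax) (Cg x Ax).
have [[df Df] [dg Dg]] := (Cf, Cg); split=> [x Ax|v].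
  exact: differentiableM (df x Ax) (dg x Ax).
have Cfg : Ck k A (fun x => f x * 'D_v g x + g x * 'D_v f x).
  by apply: CkD oA (IHk _ _ (CkW Cf) (Dg v)) (IHk _ _ (CkW Cg) (Df v)).
apply: Ck_eq Cfg => // x Ax; apply/esym.
by apply: deriveM; apply: diff_derivable; [exact: df|exact: dg].
Qed.

Lemma Ck_mxP V k (A : set V) m n (M : V -> 'M[R]_(m, n)) : open A ->
  Ck k A M <-> forall i j, Ck k A (fun x => M x i j).
Proof.
move=> oA; elim: k M => [|k IHk] M.
  split=> [cM i j x Ax|cM x Ax].
    by have /continuous_mxP := cM x Ax; apply.
  by apply/continuous_mxP => i j; exact: cM.
split=> [[dM DM] i j|CM].
  split=> [x Ax|v]; first by have /differentiable_mxP := dM x Ax; apply.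
  have /IHk/(_ i j) := DM v; apply: Ck_eq => // x Ax.
  by rewrite derive_mxE //; apply: diff_derivable; exact: dM.
have dM x : A x -> differentiable M x.
  by move=> Ax; apply/differentiable_mxP => i j; have [+ _] := CM i j; apply.
split=> // v; apply/IHk => i j; have [_ /(_ v)] := CM i j.
apply: Ck_eq => // x Ax.
by rewrite derive_mxE //; apply: diff_derivable; exact: dM.
Qed.

Lemma Ck_mulmx V k (A : set V) m n p (M : V -> 'M[R]_(m, n))
    (N : V -> 'M[R]_(n, p)) : open A ->
  Ck k A M -> Ck k A N -> Ck k A (fun x => M x *m N x).
Proof.
move=> oA /Ck_mxP CM /Ck_mxP CN; apply/Ck_mxP => // i j.
under eq_fun do rewrite mxE.
by apply: Ck_sum => // l; apply: CkM => //; [exact: CM|exact: CN].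
Qed.

Lemma Ck_trmx V k (A : set V) m n (M : V -> 'M[R]_(m, n)) : open A ->
  Ck k A M -> Ck k A (fun x => (M x)^T).
Proof.
move=> oA /Ck_mxP CM; apply/Ck_mxP => // i j.
by under eq_fun do rewrite mxE; exact: CM.
Qed.

(** A partial derivative is a directional derivative along [(v, 0)]; smoothness in both variables
    therefore passes to slices. *)
Lemma derive_slicel V V' W (f : V * V' -> W) x y v :
  'D_v (fun x => f (x, y)) x = 'D_(v, 0) f (x, y).
Proof.
rewrite /derive (_ : (fun h : R => _) = fun h : R =>
  h^-1 *: ((f \o shift (x, y)) (h *: (v, 0)) - f (x, y))) //.
apply/funext => h /=; congr (_ *: (f _ - _)).
by apply/pair_equal_spec; rewrite /= scaler0 add0r.
Qed.

Lemma derive_slicer V V' W (f : V * V' -> W) x y v :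
  'D_v (fun y => f (x, y)) y = 'D_(0, v) f (x, y).
Proof.
rewrite /derive (_ : (fun h : R => _) = fun h : R =>
  h^-1 *: ((f \o shift (x, y)) (h *: (0, v)) - f (x, y))) //.
apply/funext => h /=; congr (_ *: (f _ - _)).
by apply/pair_equal_spec; rewrite /= scaler0 add0r.
Qed.

Lemma Ck_slicel V V' W k (A : set (V * V')) (f : V * V' -> W) y :
  Ck k A f -> Ck k [set x | A (x, y)] (fun x => f (x, y)).
Proof.
elim: k f => [|k IHk] f.
  move=> cf x Ax; apply: (@continuous_comp _ _ _ (fun x => (x, y)) f); last exact: cf.
  by apply: cvg_pair => //=; exact: cvg_cst.
move=> [df Df]; split=> [x Ax|v].
  apply: (@differentiable_comp _ _ _ _ (fun x => (x, y)) f); last exact: df.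
  exact: differentiable_pair.
rewrite (_ : 'D_v _ = fun x => 'D_(v, 0) f (x, y)); first exact: IHk (Df _).
by apply/funext => ?; exact: derive_slicel.
Qed.

Lemma Ck_slicer V V' W k (A : set (V * V')) (f : V * V' -> W) x :
  Ck k A f -> Ck k [set y | A (x, y)] (fun y => f (x, y)).
Proof.
elim: k f => [|k IHk] f.
  move=> cf y Ay; apply: (@continuous_comp _ _ _ (fun y => (x, y)) f); last exact: cf.
  by apply: cvg_pair => //=; exact: cvg_cst.
move=> [df Df]; split=> [y Ay|v].
  apply: (@differentiable_comp _ _ _ _ (fun y => (x, y)) f); last exact: df.
  exact: differentiable_pair.
rewrite (_ : 'D_v _ = fun y => 'D_(0, v) f (x, y)); first exact: IHk (Df _).
by apply/funext => ?; exact: derive_slicer.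
Qed.

Let derive_line V (f : V -> R) x u t : differentiable f (x + t *: u) ->
  is_derive t 1 (fun s : R => f (x + s *: u)) ('D_u f (x + t *: u)).
Proof.
move=> df.
have dl : is_derive t (1 : R) (fun s : R => x + s *: u) u.
  apply: DeriveDef.
  - apply: derivableD; first exact: derivable_cst.
    by apply/derivable1_diffP; exact: differentiableZl.
  rewrite deriveD; [|exact: derivable_cst|]; last first.
    by apply/derivable1_diffP; exact: differentiableZl.
  rewrite derive_cst add0r deriveE; last exact: differentiableZl.
  by rewrite diffZl //= diff_val /= scale1r.
have dl' : differentiable (fun s : R => x + s *: u) t.
  by apply/derivable1_diffP; exact: ex_derive.
apply: DeriveDef.
  by apply: diff_derivable; exact: (@differentiable_comp _ _ _ _ (fun s : R => x + s *: u)).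
by rewrite (@derive_comp _ _ _ _ (fun s : R => x + s *: u) f) // derive_val.
Qed.

(** The mean value theorem is used twice: along [u] for the difference [p] of two parallel sides,
    then along [v] for the derivative ['D_u f]. *)
Let square_MVT V (f : V -> R) (A : set V) x u v (h : R) : 0 < h ->
  (forall s t, 0 <= s <= h -> 0 <= t <= h -> A (x + s *: u + t *: v)) ->
  Ck 2 A f ->
  exists s t, [/\ 0 <= s <= h, 0 <= t <= h &
    f (x + h *: u + h *: v) - f (x + h *: u) - f (x + h *: v) + f x =
    'D_v ('D_u f) (x + s *: u + t *: v) * h * h].
Proof.
move=> h0 hA [df /(_ u)[dDf _]].
have itvP t : t \in `]0, h[ -> 0 <= t <= h.
  by rewrite in_itv /= => /andP[/ltW -> /ltW ->].
pose p s : R := f (x + h *: v + s *: u) - f (x + s *: u).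
have dp s : 0 <= s <= h -> is_derive s (1 : R) p
    ('D_u f (x + h *: v + s *: u) - 'D_u f (x + s *: u)).
  move=> sh; apply: is_deriveB; apply: derive_line; apply: df.
    by rewrite addrAC; apply: hA => //; rewrite lexx ltW.
  by have := hA s 0 sh; rewrite scale0r addr0; apply; rewrite lexx ltW.
have [s /itvP sh psE] : exists2 s, s \in `]0, h[ &
    p h - p 0 = ('D_u f (x + h *: v + s *: u) - 'D_u f (x + s *: u)) * (h - 0).
  apply: (MVT h0) => [s /itvP /dp //|].
  apply: derivable_within_continuous => s; rewrite in_itv /= => /dp ds.
  exact: ex_derive.
pose q t : R := 'D_u f (x + s *: u + t *: v).
have dq t : 0 <= t <= h -> is_derive t (1 : R) q ('D_v ('D_u f) (x + s *: u + t *: v)).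
  by move=> th; apply: derive_line; apply: dDf; exact: hA.
have [t /itvP th qtE] : exists2 t, t \in `]0, h[ &
    q h - q 0 = 'D_v ('D_u f) (x + s *: u + t *: v) * (h - 0).
  apply: (MVT h0) => [t /itvP /dq //|].
  apply: derivable_within_continuous => t; rewrite in_itv /= => /dq dt.
  exact: ex_derive.
exists s, t; split => //.
move: psE qtE; rewrite /p /q !subr0 !scale0r !addr0 => psE qtE.
rewrite -qtE [x + s *: u + h *: v]addrAC -psE [x + h *: u + h *: v]addrAC.
by rewrite opprB addrA [RHS]addrAC.
Qed.

(** The passage to the limit in Schwarz's theorem: the two mixed derivatives are known to agree only
    at two distinct points near [x]. Half of a supposed gap at [x] serves as epsilon. *)
Let continuous_near_eq V (g1 g2 : V -> R) x :
  {for x, continuous g1} -> {for x, continuous g2} ->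
  (forall r : R, 0 < r -> exists y1 y2, [/\ ball x r y1, ball x r y2 & g1 y1 = g2 y2]) ->
  g1 x = g2 x.
Proof.
move=> c1 c2 H; apply/eqP; rewrite -subr_eq0; apply/negPn/negP => neq.
have e0 : 0 < `|g1 x - g2 x| / 2 by rewrite divr_gt0 // normr_gt0.
have /cvgrPdist_lt/(_ _ e0) n1 := c1; have /cvgrPdist_lt/(_ _ e0) n2 := c2.
have /nbhs_ballP[r1 r10 P1] := n1; have /nbhs_ballP[r2 r20 P2] := n2.
have r0 : 0 < Num.min r1 r2 by rewrite lt_min; apply/andP.
have [y1 [y2 [ry1 ry2 E]]] := H _ r0.
have b1 : `|g1 x - g1 y1| < `|g1 x - g2 x| / 2.
  by apply: P1; apply: le_ball ry1; rewrite ge_min lexx.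
have b2 : `|g2 x - g2 y2| < `|g1 x - g2 x| / 2.
  by apply: P2; apply: le_ball ry2; rewrite ge_min lexx orbT.
have : `|g1 x - g2 x| < `|g1 x - g2 x|; last by rewrite ltxx.
rewrite {2}[`|g1 x - g2 x|]splitr; apply: le_lt_trans (ltrD b1 b2).
by rewrite E [X in _ <= _ + X]distrC; apply: le_trans (ler_normD _ _); rewrite addrA subrK.
Qed.

(** The second difference over a small parallelogram is symmetric in [u] and [v], and equals [h * h]
    times either mixed derivative at some point of the parallelogram. *)
Let schwarz_real V (f : V -> R) (A : set V) x u v :
  open A -> A x -> Ck 2 A f -> 'D_v ('D_u f) x = 'D_u ('D_v f) x.
Proof.
move=> oA Ax Cf; apply: (@continuous_near_eq V ('D_v ('D_u f)) ('D_u ('D_v f))).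
- by have [_ /(_ u) [_ /(_ v)]] := Cf; apply.
- by have [_ /(_ v) [_ /(_ u)]] := Cf; apply.
move=> r' r'0.
have /nbhs_ballP[r'' /= r''0 rA] : nbhs x A by exact: open_nbhs_nbhs.
pose r := Num.min r' r''.
have r0 : 0 < r by rewrite lt_min r'0.
(* This size keeps the whole parallelogram in the ball of radius [r]; the summand 1 keeps the
   denominator positive when [u] and [v] vanish. *)
pose h := r / (`|u| + `|v| + 1).
have k0 : 0 < `|u| + `|v| + 1 by rewrite ltr_wpDl // addr_ge0.
have h0 : 0 < h by rewrite divr_gt0.
have hr s t a b : `|a| + `|b| = `|u| + `|v| -> 0 <= s <= h -> 0 <= t <= h ->
    ball x r (x + s *: a + t *: b).
  move=> ab /andP[s0 sh] /andP[t0 th]; rewrite -ball_normE /= -addrA opprD addrA.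
  rewrite subrr sub0r normrN.
  apply: (@le_lt_trans _ _ (h * (`|u| + `|v|))).
    rewrite -ab mulrDr; apply: le_trans (ler_normD _ _) _.
    by rewrite !normrZ !ger0_norm // lerD // ler_wpM2r.
  by rewrite /h -mulrA gtr_pMr // mulrC ltr_pdivrMr // mul1r ltrDl.
have rr' y : ball x r y -> ball x r' y by apply: le_ball; rewrite ge_min lexx.
have rr'' y : ball x r y -> A y.
  by move=> ry; apply: rA; apply: le_ball ry; rewrite ge_min lexx orbT.
have [s [t [sh th E1]]] : exists s t, [/\ 0 <= s <= h, 0 <= t <= h &
    f (x + h *: u + h *: v) - f (x + h *: u) - f (x + h *: v) + f x =
    'D_v ('D_u f) (x + s *: u + t *: v) * h * h].
  by apply: square_MVT h0 _ Cf => s t sh th; apply: rr''; exact: hr.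
have [s' [t' [sh' th' E2]]] : exists s t, [/\ 0 <= s <= h, 0 <= t <= h &
    f (x + h *: v + h *: u) - f (x + h *: v) - f (x + h *: u) + f x =
    'D_u ('D_v f) (x + s *: v + t *: u) * h * h].
  by apply: square_MVT h0 _ Cf => s' t' sh' th'; apply: rr''; apply: hr => //; exact: addrC.
exists (x + s *: u + t *: v), (x + s' *: v + t' *: u); split.
- by apply: rr'; exact: hr.
- by apply: rr'; apply: hr => //; exact: addrC.
have hN : h != 0 by rewrite gt_eqF.
have cancel (a b : R) : a * h * h = b * h * h -> a = b.
  by move=> /(mulIf hN) /(mulIf hN).
apply: cancel; apply: etrans (esym E1) (etrans _ E2).
have swap (a b c d : R) : a - b - c + d = a - c - b + d by congr (_ + _); exact: addrAC.
by apply: etrans (swap _ _ _ _) _; rewrite (addrAC x (h *: u)).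
Qed.

Lemma schwarz V (A : set V) m n (f : V -> 'M[R]_(m, n)) x u v :
  open A -> A x -> Ck 2 A f -> 'D_v ('D_u f) x = 'D_u ('D_v f) x.
Proof.
move=> oA Ax Cf; have [df Df] := Cf.
have DDE a b i j : 'D_a ('D_b f) x i j = 'D_a ('D_b (fun y => f y i j)) x.
  rewrite derive_mxE; last by apply: diff_derivable; have [+ _] := Df b; apply.
  apply: near_eq_derive; apply: near_open oA Ax _ => y Ay.
  by rewrite derive_mxE //; apply: diff_derivable; exact: df.
apply/matrixP => i j; apply: etrans (DDE v u i j) (etrans _ (esym (DDE u v i j))).
have Cfij : Ck 2 A (fun y => f y i j) by have /Ck_mxP := Cf; apply.
exact: (schwarz_real u v oA Ax Cfij).
Qed.

End Ck.

(** * Curvature of a left-invariant connection *)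

Section EntrywiseModule.
Context (R : comNzRingType) (m n : nat).
Implicit Types A B : 'M[R]_(m, n).

Lemma addmx_entry A B i j : (A + B) i j = A i j + B i j.
Proof. by rewrite mxE. Qed.

Lemma oppmx_entry A i j : (- A) i j = - A i j.
Proof. by rewrite mxE. Qed.

Lemma scalemx_entry k A i j : (k *: A) i j = k * A i j.
Proof. by rewrite mxE. Qed.

Lemma zeromx_entry i j : (0 : 'M[R]_(m, n)) i j = 0.
Proof. by rewrite mxE. Qed.

End EntrywiseModule.

(* Decides identities of the module of matrices, treating products as atoms. *)
Ltac mxabel :=
  repeat match goal with
    |- context [@mulmx _ _ _ _ ?A ?B] => move: (mulmx A B) => ?
  end;
  apply/matrixP => ? ?;
  rewrite ?(addmx_entry, oppmx_entry, scalemx_entry, zeromx_entry);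
  repeat match goal with |- context [@fun_of_matrix ?T ?m ?n ?A ?i ?j] =>
    generalize (@fun_of_matrix T m n A i j); intro end;
  ring.

(** * Skew endomorphisms and bilinear forms in matrix notation *)

Section SkewMatrices.
Context (R : comNzRingType) (n : nat) (S : 'M[R]_n).

(* The Lie algebra of the orthogonal group of S. *)
Definition skew_wrt (M : 'M[R]_n) : Prop := M *m S + S *m M^T = 0.

Lemma skew_wrtB (M N : 'M[R]_n) : skew_wrt M -> skew_wrt N -> skew_wrt (M - N).
Proof.
rewrite /skew_wrt => /eqP; rewrite addr_eq0 => /eqP hM /eqP; rewrite addr_eq0 => /eqP hN.
by rewrite mulmxBl hM hN linearB /= mulmxBr; mxabel.
Qed.

Lemma skew_wrt_comm (M N : 'M[R]_n) :
  skew_wrt M -> skew_wrt N -> skew_wrt (M *m N - N *m M).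
Proof.
rewrite /skew_wrt => /eqP; rewrite addr_eq0 => /eqP hM /eqP; rewrite addr_eq0 => /eqP hN.
rewrite mulmxBl -!mulmxA hM hN !mulmxN !mulmxA hM hN !mulNmx !opprK.
by rewrite linearB /= !trmx_mul mulmxBr !mulmxA; mxabel.
Qed.

End SkewMatrices.

Section Bform.
Context (R : realType) (n : nat) (S : 'M[R]_n).
Implicit Types u v w : 'rV[R]_n.

Lemma bformDl u v w : bform S (u + v) w = bform S u w + bform S v w.
Proof. by rewrite /bform !mulmxDl mxE. Qed.

Lemma bformDr u v w : bform S u (v + w) = bform S u v + bform S u w.
Proof. by rewrite /bform linearD /= mulmxDr mxE. Qed.

Lemma bformZl k u v : bform S (k *: u) v = k * bform S u v.
Proof. by rewrite /bform -!scalemxAl mxE. Qed.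

Lemma bformZr k u v : bform S u (k *: v) = k * bform S u v.
Proof. by rewrite /bform linearZ /= -scalemxAr mxE. Qed.

Lemma bformNl u v : bform S (- u) v = - bform S u v.
Proof. by rewrite -scaleN1r bformZl mulN1r. Qed.

Lemma bformNr u v : bform S u (- v) = - bform S u v.
Proof. by rewrite -scaleN1r bformZr mulN1r. Qed.

Lemma bform0l v : bform S 0 v = 0.
Proof. by rewrite -(scale0r 0) bformZl mul0r. Qed.

Lemma bform0r v : bform S v 0 = 0.
Proof. by rewrite -(scale0r 0) bformZr mul0r. Qed.

Lemma bformBl u v w : bform S (u - v) w = bform S u w - bform S v w.
Proof. by rewrite bformDl bformNl. Qed.

Lemma bformC u v : S^T = S -> bform S u v = bform S v u.
Proof.
move=> Ssym; rewrite /bform -[in LHS](trmxK (u *m S *m v^T)) mxE.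
by rewrite !trmx_mul trmxK Ssym mulmxA.
Qed.

Lemma bform_mulmx (P : 'M[R]_n) u v :
  bform S (u *m P) (v *m P) = bform (P *m S *m P^T) u v.
Proof. by rewrite /bform trmx_mul !mulmxA. Qed.

Lemma bform_delta (i j : 'I_n) : bform S (delta_mx 0 i) (delta_mx 0 j) = S i j.
Proof. by rewrite /bform trmx_delta -rowE -colE !mxE. Qed.

Lemma skew_wrtP (M : 'M[R]_n) u v :
  skew_wrt S M -> bform S (u *m M) v = - bform S u (v *m M).
Proof.
move=> /(congr1 (fun N => (u *m N *m v^T) 0 0)) /eqP.
rewrite mulmx0 mul0mx [X in _ == X]mxE mulmxDr mulmxDl mxE addr_eq0 => /eqP.
by rewrite /bform trmx_mul !mulmxA.
Qed.

End Bform.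

(** * Curvature and Bianchi identities of a connection with constant coefficients *)

Section LieAlgebra.
Context (R : comNzRingType) (n : nat).
Variable L : {linear 'rV[R]_n -> 'M[R]_n}.
Implicit Types a b c z : 'rV[R]_n.

(* The product a.b of a left-invariant connection is b *m L a. *)
Definition lie_bracket a b : 'rV[R]_n := b *m L a - a *m L b.

(** Operators act on row vectors from the right, so [L b *m L a] stands for the derivative along [b]
    followed by the one along [a]. *)
Definition lie_curvature a b : 'M[R]_n :=
  L b *m L a - L a *m L b - L (lie_bracket a b).

(** The components of R are constant in an invariant frame, so its covariant derivative is the
    action of [L z] as a derivation on all arguments. *)
Definition nabla_lie_curvature z a b : 'M[R]_n :=
  lie_curvature a b *m L z - L z *m lie_curvature a b
  - lie_curvature (a *m L z) b - lie_curvature a (b *m L z).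

Local Notation brk := lie_bracket.
Local Notation Rm := lie_curvature.
Local Notation dR := nabla_lie_curvature.

Let LD a b : L (a + b) = L a + L b. Proof. exact: raddfD. Qed.
Let LZ k a : L (k *: a) = k *: L a. Proof. exact: linearZ. Qed.
Let LN a : L (- a) = - L a. Proof. exact: raddfN. Qed.

Lemma lie_bracketC a b : brk a b = - brk b a.
Proof. by rewrite /brk opprB. Qed.

Lemma lie_bracketDl a b c : brk (a + b) c = brk a c + brk b c.
Proof. by rewrite /brk LD mulmxDr mulmxDl; mxabel. Qed.

Lemma lie_bracketZl k a b : brk (k *: a) b = k *: brk a b.
Proof. by rewrite /brk LZ -scalemxAr -scalemxAl scalerBr. Qed.

Lemma lie_curvatureC a b : Rm a b = - Rm b a.
Proof.
by rewrite /Rm [in LHS]lie_bracketC LN !opprD !opprK [_ *m _ + _]addrC.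
Qed.

Lemma lie_curvatureDl a b c : Rm (a + b) c = Rm a c + Rm b c.
Proof.
rewrite /Rm lie_bracketDl !LD mulmxDl mulmxDr.
by mxabel.
Qed.

Lemma lie_curvatureZl k a b : Rm (k *: a) b = k *: Rm a b.
Proof. by rewrite /Rm lie_bracketZl !LZ -scalemxAl -scalemxAr !scalerBr. Qed.

Lemma lie_curvatureDr a b c : Rm a (b + c) = Rm a b + Rm a c.
Proof. by rewrite lie_curvatureC lie_curvatureDl opprD -!lie_curvatureC. Qed.

Lemma lie_curvatureZr k a b : Rm a (k *: b) = k *: Rm a b.
Proof. by rewrite lie_curvatureC lie_curvatureZl -scalerN -lie_curvatureC. Qed.

Lemma lie_curvatureNl a b : Rm (- a) b = - Rm a b.
Proof. by rewrite -scaleN1r lie_curvatureZl scaleN1r. Qed.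

Lemma nabla_lie_curvatureC z a b : dR z a b = - dR z b a.
Proof.
rewrite /dR (lie_curvatureC a b) (lie_curvatureC _ b) (lie_curvatureC a).
by rewrite mulNmx mulmxN; mxabel.
Qed.

Lemma nabla_lie_curvatureDl z a b c : dR z (a + b) c = dR z a c + dR z b c.
Proof.
rewrite /dR (mulmxDl a b) !lie_curvatureDl (mulmxDl (Rm a c)) (mulmxDr (L z)).
by mxabel.
Qed.

Lemma nabla_lie_curvatureZl z k a b : dR z (k *: a) b = k *: dR z a b.
Proof.
by rewrite /dR -scalemxAl !lie_curvatureZl -scalemxAl -scalemxAr !scalerBr.
Qed.

Lemma nabla_lie_curvature_linear z z' k a b :
  dR (k *: z + z') a b = k *: dR z a b + dR z' a b.
Proof.
rewrite /dR !LD !LZ (mulmxDr (Rm a b)) (mulmxDl _ _ (Rm a b)) (mulmxDr a) (mulmxDr b).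
rewrite -!scalemxAr -scalemxAl.
rewrite !lie_curvatureDl !lie_curvatureDr !lie_curvatureZl !lie_curvatureZr.
by mxabel.
Qed.

Lemma lie_curvature_skew (S : 'M[R]_n) a b :
  (forall a, skew_wrt S (L a)) -> skew_wrt S (Rm a b).
Proof. by move=> skL; apply: skew_wrtB => //; exact: skew_wrt_comm. Qed.

Lemma nabla_lie_curvature_skew (S : 'M[R]_n) z a b :
  (forall a, skew_wrt S (L a)) -> skew_wrt S (dR z a b).
Proof.
move=> skL; have skR c d := lie_curvature_skew c d skL.
by apply: skew_wrtB; [apply: skew_wrtB|]; [exact: skew_wrt_comm| |].
Qed.

Hypothesis bianchi1 : forall a b c, c *m Rm a b + a *m Rm b c + b *m Rm c a = 0.

(** Expanded in products of [L], the cyclic sum of double brackets is the negative of the first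
    Bianchi sum. *)
Lemma jacobi a b c : brk (brk a b) c + brk (brk b c) a + brk (brk c a) b = 0.
Proof.
have := bianchi1 a b c; rewrite /Rm !mulmxBr !mulmxA {}/brk.
move=> E; rewrite -oppr0 -{}E.
rewrite !mulmxBl.
by mxabel.
Qed.

(** The terms in which [L] acts on an argument of R pair up into brackets. The rest is the Jacobi
    identity for commutators of matrices together with the image under [L] of the Jacobi identity
    for the bracket. *)
Lemma bianchi2 z a b : dR z a b + dR a b z + dR b z a = 0.
Proof.
have E : dR z a b + dR a b z + dR b z a =
    (Rm a b *m L z - L z *m Rm a b) + (Rm b z *m L a - L a *m Rm b z)
    + (Rm z a *m L b - L b *m Rm z a)
    - (Rm (brk z a) b + Rm (brk a b) z + Rm (brk b z) a).
  rewrite /dR /brk !lie_curvatureDl !lie_curvatureNl.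
  rewrite (lie_curvatureC a (b *m _)) (lie_curvatureC b (z *m _)) (lie_curvatureC z (a *m _)).
  set x1 := Rm a b *m _; set x2 := _ *m Rm a b.
  by mxabel.
have := congr1 L (jacobi z a b).
rewrite (LD (_ + brk (brk a b) z)) (LD (brk (brk z a) b)) raddf0 => J.
rewrite E -[RHS]J /Rm !mulmxBl !mulmxBr !mulmxA.
by mxabel.
Qed.

Lemma mul_nabla_lie_curvature (u : 'rV[R]_n) z a b :
  u *m dR z a b = u *m Rm a b *m L z - u *m L z *m Rm a b
    - u *m Rm (a *m L z) b - u *m Rm a (b *m L z).
Proof.
have dist (A B C D : 'M[R]_n) : u *m (A *m L z - L z *m B - C - D) =
  u *m A *m L z - u *m L z *m B - u *m C - u *m D by rewrite !mulmxBr !mulmxA.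
exact: dist.
Qed.

(** A derivation preserves the cyclic identity: [L z] is applied to the identity for [a], [b], [c],
    and the three identities with one argument replaced by its derivative are subtracted. *)
Lemma nabla_bianchi1 z a b c :
  c *m dR z a b + a *m dR z b c + b *m dR z c a = 0.
Proof.
have B0 := congr1 (fun u => u *m L z) (bianchi1 a b c).
have Ba := bianchi1 (a *m L z) b c; have Bb := bianchi1 a (b *m L z) c.
have Bc := bianchi1 a b (c *m L z).
rewrite /= mul0mx (mulmxDl (_ + _)) (mulmxDl (c *m _)) in B0.
have E : forall B0 Ba Bb Bc : 'rV[R]_n, B0 = 0 -> Ba = 0 -> Bb = 0 -> Bc = 0 ->
  B0 - Ba - Bb - Bc = 0 by move=> ? ? ? ? -> -> -> ->; rewrite !subr0.
rewrite -[RHS](E _ _ _ _ B0 Ba Bb Bc) !mul_nabla_lie_curvature.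
by mxabel.
Qed.

End LieAlgebra.

(** * Null frames and the algebra of pp-waves *)

Section NullFrame.
Context (R : realType).
Implicit Types (S : 'M[R]_4) (u : 'rV[R]_4).

Record null_frame S (nu e1 e2 mu : 'rV[R]_4) : Prop := NullFrame {
  frame_nunu : bform S nu nu = 0;
  frame_nu1 : bform S nu e1 = 0;
  frame_nu2 : bform S nu e2 = 0;
  frame_numu : bform S nu mu = 1;
  frame_11 : bform S e1 e1 = 1;
  frame_12 : bform S e1 e2 = 0;
  frame_1mu : bform S e1 mu = 0;
  frame_22 : bform S e2 e2 = 1;
  frame_2mu : bform S e2 mu = 0;
  frame_mumu : bform S mu mu = 0 }.

Let minkowski : 'M[R]_4 := diag_mx (\row_(j < 4) (if j == 0%N :> nat then -1 else 1)).

Let row4 (a b c d : R) : 'rV[R]_4 := \row_j nth 0 [:: a; b; c; d] j.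

Let minkowskiE a b c d a' b' c' d' :
  bform minkowski (row4 a b c d) (row4 a' b' c' d') =
  - (a * a') + b * b' + c * c' + d * d'.
Proof.
rewrite /bform /minkowski mul_mx_diag mxE !big_ord_recl big_ord0 !mxE /=.
by ring.
Qed.

Let row4E u : u = row4 (u 0 0) (u 0 1) (u 0 2%:R) (u 0 3%:R).
Proof.
apply/rowP => j; rewrite mxE.
by case: j => [[|[|[|[|//]]]] ?] /=; congr (u 0 _); apply/val_inj.
Qed.

Let direction_frame (a b c : R) : a ^+ 2 + b ^+ 2 + c ^+ 2 = 1 ->
  exists p q r p' q' r' : R,
    [/\ a * p + b * q + c * r = 0, a * p' + b * q' + c * r' = 0,
        p * p + q * q + r * r = 1, p * p' + q * q' + r * r' = 0 &
        p' * p' + q' * q' + r' * r' = 1].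
Proof.
move=> abc; have Hc : c ^+ 2 = 1 - a ^+ 2 - b ^+ 2 by rewrite -abc; ring.
have [a1|a1] := eqVneq (1 + a) 0.
  have aE : a = -1 by apply/eqP; rewrite -addr_eq0 addrC a1.
  have : b ^+ 2 + c ^+ 2 = 0 by rewrite Hc aE; ring.
  move/eqP; rewrite paddr_eq0 ?sqr_ge0 // !sqrf_eq0 => /andP[/eqP -> /eqP ->].
  by exists 0, 1, 0, 0, 0, 1; split; ring.
(* The reflection exchanging (1,0,0) and -(a,b,c) sends the other two basis vectors to an
   orthonormal basis of the complement of (a,b,c). Its coefficient is [k], which is why a = -1 was
   treated apart. *)
pose k := (1 + a)^-1.
have Hk : k * a = 1 - k by rewrite -(mulVf a1) /k; ring.
exists (- b), (1 - k * b ^+ 2), (- k * b * c), (- c), (- k * b * c), (1 - k * c ^+ 2).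
by split; ring: Hk Hc.
Qed.

(** A nonzero null vector is t(1,a,b,c) with (a,b,c) a unit vector. The spacelike part of the frame
    is purely spatial and orthogonal to (a,b,c), and [mu] is the multiple of the opposite null
    vector (-1,a,b,c) normalized by [s]. *)
Let minkowski_null_frame u : u != 0 -> bform minkowski u u = 0 ->
  exists e1 e2 mu, null_frame minkowski u e1 e2 mu.
Proof.
rewrite (row4E u); move: (u 0 0) (u 0 1) (u 0 2%:R) (u 0 3%:R) => t x y z.
move=> un0; rewrite minkowskiE => null.
have t0 : t != 0.
  apply: contra_neq un0 => t0.
  have sq : x ^+ 2 + y ^+ 2 + z ^+ 2 = 0 by rewrite -[RHS]null t0; ring.
  have := sq; move=> /eqP; rewrite !paddr_eq0 ?addr_ge0 ?sqr_ge0 // !sqrf_eq0.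
  move=> /andP[/andP[/eqP -> /eqP ->] /eqP ->]; rewrite t0.
  by apply/rowP => j; rewrite !mxE; case: j => [[|[|[|[|//]]]] ?].
have [a [xE]] : exists a, x = t * a by exists (x / t); rewrite mulrC divfK.
have [b yE] : exists a, y = t * a by exists (y / t); rewrite mulrC divfK.
have [c zE] : exists a, z = t * a by exists (z / t); rewrite mulrC divfK.
subst x y z.
have abc : a ^+ 2 + b ^+ 2 + c ^+ 2 = 1.
  apply: (mulfI (mulf_neq0 t0 t0)); apply/eqP; rewrite -subr_eq0 -null; apply/eqP.
  by ring.
have [p [q [r [p' [q' [r' [h1 h2 h3 h4 h5]]]]]]] := direction_frame abc.
pose s := (2 * t)^-1.
have Hs : s * t = 2^-1 by rewrite /s invfM mulfVK.
exists (row4 0 p q r), (row4 0 p' q' r'), (row4 (- s) (s * a) (s * b) (s * c)).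
have Hc : c ^+ 2 = 1 - a ^+ 2 - b ^+ 2 by rewrite -abc; ring.
split; rewrite minkowskiE.
- by ring: Hc.
- by transitivity (t * (a * p + b * q + c * r)); [ring|rewrite h1 mulr0].
- by transitivity (t * (a * p' + b * q' + c * r')); [ring|rewrite h2 mulr0].
- rewrite (_ : _ + _ = s * t * (1 + a ^+ 2 + b ^+ 2 + c ^+ 2)); last by ring.
  by rewrite Hs Hc; field.
- by rewrite mulr0 oppr0 add0r.
- by rewrite mulr0 oppr0 add0r.
- by transitivity (s * (a * p + b * q + c * r)); [ring|rewrite h1 mulr0].
- by rewrite mulr0 oppr0 add0r.
- by transitivity (s * (a * p' + b * q' + c * r')); [ring|rewrite h2 mulr0].
- by ring: Hc.
Qed.

Lemma null_frame_exists S nu : lorentzian_form S -> nu != 0 ->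
  bform S nu nu = 0 -> exists e1 e2 mu, null_frame S nu e1 e2 mu.
Proof.
move=> [P Pu]; rewrite -/minkowski => PS nu0 nunu.
have bE a b : bform S a b = bform minkowski (a *m invmx P) (b *m invmx P).
  by rewrite -PS -bform_mulmx !mulmxKV.
have [|e1 [e2 [mu [h1 h2 h3 h4 h5 h6 h7 h8 h9 h10]]]] :=
    @minkowski_null_frame (nu *m invmx P) _ (etrans (esym (bE _ _)) nunu).
  by apply: contra_neq nu0 => E; rewrite -[nu](mulmxKV Pu) E mul0mx.
by exists (e1 *m P), (e2 *m P), (mu *m P); split; rewrite bE ?(mulmxK Pu).
Qed.

(** * Expansion and trace in a null frame *)

Section NullFrameTheory.
Variables (S : 'M[R]_4) (nu e1 e2 mu : 'rV[R]_4).
Hypothesis Ssym : S^T = S.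
Hypothesis fr : null_frame S nu e1 e2 mu.
Local Notation "<[ a , b ]>" := (bform S a b).

Let P : 'M[R]_4 := \matrix_(i < 4) nth 0 [:: nu; e1; e2; mu] i.
Let K : 'M[R]_4 := \matrix_(i < 4, j < 4)
  nth 0 (nth [::] [:: [:: 0; 0; 0; 1]; [:: 0; 1; 0; 0]; [:: 0; 0; 1; 0];
                      [:: 1; 0; 0; 0]] i) j.

Let PSP : P *m S *m P^T = K.
Proof.
have [h1 h2 h3 h4 h5 h6 h7 h8 h9 h10] := fr.
apply/matrixP => i j; rewrite -bform_delta -bform_mulmx -!rowE !rowK mxE.
by case: i => [[|[|[|[|//]]]] ?]; case: j => [[|[|[|[|//]]]] ?] /=;
  rewrite ?h1 ?h2 ?h3 ?h4 ?h5 ?h6 ?h7 ?h8 ?h9 ?h10 // bformC // ?h2 ?h3 ?h4 ?h5 ?h6 ?h7 ?h9.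
Qed.

Let KK : K *m K = 1%:M.
Proof.
apply/matrixP => i j; rewrite !mxE !big_ord_recl big_ord0 !mxE.
by case: i => [[|[|[|[|//]]]] ?]; case: j => [[|[|[|[|//]]]] ?];
  rewrite /= ?mulr0 ?mul0r ?mulr1 ?addr0 ?add0r.
Qed.

Let frame_inv : S *m P^T *m K *m P = 1%:M.
Proof. by apply: mulmx1C; rewrite !mulmxA PSP KK. Qed.

(** The Gram matrix [K] of the frame is its own inverse and exchanges the two null vectors, so the
    coefficient of [nu] is the product with [mu] and conversely. *)
Lemma frame_decomp a :
  a = <[a, mu]> *: nu + <[a, e1]> *: e1 + <[a, e2]> *: e2 + <[a, nu]> *: mu.
Proof.
rewrite -[LHS]mulmx1 -frame_inv !mulmxA.
have aSP : a *m S *m P^T = \row_j nth 0 [:: <[a, nu]>; <[a, e1]>; <[a, e2]>; <[a, mu]>] j.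
  apply/rowP => j; transitivity (<[a, row j P]>).
    by rewrite /bform [LHS]mxE [RHS]mxE; apply: eq_bigr => k _; rewrite !mxE.
  by rewrite rowK mxE; case: j => [[|[|[|[|//]]]] ?].
have -> : a *m S *m P^T *m K =
    \row_j nth 0 [:: <[a, mu]>; <[a, e1]>; <[a, e2]>; <[a, nu]>] j.
  rewrite aSP; apply/rowP => j; rewrite !mxE !big_ord_recl big_ord0 !mxE /=.
  by case: j => [[|[|[|[|//]]]] ?]; rewrite /= ?mulr0 ?mulr1 ?addr0 ?add0r.
by rewrite mulmx_sum_row !big_ord_recl big_ord0 !mxE !rowK /= addr0 !addrA.
Qed.

Lemma frame_ext a b : <[a, nu]> = <[b, nu]> -> <[a, e1]> = <[b, e1]> ->
  <[a, e2]> = <[b, e2]> -> <[a, mu]> = <[b, mu]> -> a = b.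
Proof. by move=> E1 E2 E3 E4; rewrite (frame_decomp a) E1 E2 E3 E4 -frame_decomp. Qed.

(** The frame dual to [nu], [e1], [e2], [mu] is [mu], [e1], [e2], [nu]. *)
Lemma frame_trace (M : 'M[R]_4) :
  \tr M = <[nu *m M, mu]> + <[e1 *m M, e1]> + <[e2 *m M, e2]> + <[mu *m M, nu]>.
Proof.
have -> : \tr M = \tr (P *m M *m S *m P^T *m K).
  by rewrite -[in LHS](mulmx1 M) -frame_inv mulmxA mxtrace_mulC !mulmxA.
have XE i j : (P *m M *m S *m P^T) i j = <[row i P *m M, row j P]>.
  rewrite /bform -!row_mul [LHS]mxE [RHS]mxE [RHS]mxE.
  by apply: eq_bigr => k _; rewrite !mxE.
rewrite /mxtrace !big_ord_recl big_ord0 !mxE !big_ord_recl !big_ord0 !XE !rowK !mxE /=.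
by rewrite !mulr0 !mulr1 !addr0 !add0r !addrA.
Qed.

End NullFrameTheory.
End NullFrame.

(* o and t are the values of om and th at nu, e1 and e2, and the Tij o t are
   the entries of 2 o h + t [J, h]. *)
Lemma wave_equations (R : realFieldType)
    (h11 h12 h22 o0 o1 o2 t0 t1 t2 k : R) :
  let T11 o t := 2 * o * h11 - 2 * t * h12 in
  let T12 o t := 2 * o * h12 + t * (h11 - h22) in
  let T22 o t := 2 * o * h22 + 2 * t * h12 in
  T11 o1 t1 + T12 o2 t2 = 0 -> T12 o1 t1 + T22 o2 t2 = 0 ->
  T12 o1 t1 = T11 o2 t2 -> T22 o1 t1 = T12 o2 t2 ->
  T11 o0 t0 = 0 -> T12 o0 t0 = 0 ->
  k * t0 = t1 ^+ 2 + t2 ^+ 2 ->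
  [/\ T11 o1 t1 = 0, T12 o1 t1 = 0, T22 o1 t1 = 0 &
      [/\ T11 o2 t2 = 0, T12 o2 t2 = 0 & T22 o2 t2 = 0]].
Proof.
move=> /= A1 A2 C1 C2 N1 N2 F.
have pd (x y z : R) : x * (y ^+ 2 + z ^+ 2) = 0 -> x = 0 \/ (y = 0 /\ z = 0).
  move=> /eqP; rewrite mulf_eq0 paddr_eq0 ?sqr_ge0 // !sqrf_eq0.
  by move=> /orP[/eqP|/andP[/eqP ? /eqP ?]]; [left|right].
have mul (x a b : R) : a = b -> x * a = x * b by move=> ->.
(* Combining [A1] with [C2], and [A2] with [C1], shows that both matrices T(e_i) are trace free;
   their traces are 2 o_i tr h. *)
have S1 : o1 * (h11 + h22) = 0 by lra.
have S2 : o2 * (h11 + h22) = 0 by lra.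
(* In the first alternative h is scalar, so [J, h] = 0, and either the o_i vanish or h does; in the
   second both o_i and t_i vanish. *)
suff H : (h11 = h22 /\ h12 = 0 /\ (o1 = 0 /\ o2 = 0 \/ h11 = 0)) \/
         [/\ o1 = 0, o2 = 0, t1 = 0 & t2 = 0].
  case: H => [[E [-> [[-> ->]|E']]]|[-> -> -> ->]].
  - by rewrite E; split; [..|split]; ring.
  - by rewrite -E E'; split; [..|split]; ring.
  - by split; [..|split]; ring.
have [s0|s0] := eqVneq (h11 + h22) 0; last first.
  move: S1 S2 => /eqP; rewrite mulf_eq0 (negPf s0) orbF => /eqP o10.
  move=> /eqP; rewrite mulf_eq0 (negPf s0) orbF => /eqP o20.
  subst o1 o2.
  (* With o1 = o2 = 0, [C1] and [C2] are a linear system in (t1, t2) whose determinant is minus the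
     sum of the squares of h11 - h22 and 2 h12. *)
  have [t10|[d0 h120]] : t1 = 0 \/ (h11 - h22 = 0 /\ 2 * h12 = 0).
  - apply: pd; have := mul (h11 - h22) _ _ C1; have := mul (2 * h12) _ _ C2; lra.
  - have [t20|[d0 h120]] : t2 = 0 \/ (h11 - h22 = 0 /\ 2 * h12 = 0).
    + apply: pd; have := mul (2 * h12) _ _ C1; have := mul (h11 - h22) _ _ C2; lra.
    + by right.
    + by left; split; [|split; [|left]] => //; lra.
  - by left; split; [|split; [|left]] => //; lra.
have h22E : h22 = - h11 by apply/eqP; rewrite -addr_eq0 addrC s0.
subst h22.
have null : h11 = 0 /\ h12 = 0 -> h11 = - h11 /\ h12 = 0 /\
    (o1 = 0 /\ o2 = 0 \/ h11 = 0).
  by move=> [-> ->]; rewrite oppr0; split=> //; split=> //; right.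
(* For trace-free h, [N1] and [N2] form a linear system in (o0, t0) with determinant a multiple of
   h11^2 + h12^2; eliminating o0 isolates t0. *)
have [t00|/null] : t0 = 0 \/ (h11 = 0 /\ h12 = 0); [| |by left].
  by apply: pd; have := mul h11 _ _ N2; have := mul h12 _ _ N1; lra.
have [t10 t20] : t1 = 0 /\ t2 = 0.
  move: F; rewrite t00 mulr0 => /esym/eqP.
  by rewrite paddr_eq0 ?sqr_ge0 // !sqrf_eq0 => /andP[/eqP -> /eqP ->].
subst t1 t2.
(* Once t1 = t2 = 0, the same elimination in [C1] and [C2] isolates o1, and then o2. *)
have [z10|/null] : o1 = 0 \/ (h11 = 0 /\ h12 = 0); [| |by left].
  by apply: pd; have := mul h11 _ _ C2; have := mul h12 _ _ C1; lra.
have [z20|/null] : o2 = 0 \/ (h11 = 0 /\ h12 = 0); [| |by left].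
  by apply: pd; have := mul h11 _ _ C1; have := mul h12 _ _ C2; lra.
by right.
Qed.

(** * Plane versus harmonic on the Lie algebra of a pp-wave *)

Section LieWave.
Context (R : realType).
Variables (S : 'M[R]_4) (L : {linear 'rV[R]_4 -> 'M[R]_4}).
Hypothesis Ssym : S^T = S.
Hypothesis Lskew : forall a, skew_wrt S (L a).
Local Notation Rm := (lie_curvature L).
Local Notation dR := (nabla_lie_curvature L).
Hypothesis bianchi : forall a b c, c *m Rm a b + a *m Rm b c + b *m Rm c a = 0.
Local Notation "<[ a , b ]>" := (bform S a b).
Variables nu e1 e2 mu : 'rV[R]_4.
Hypothesis fr : null_frame S nu e1 e2 mu.
Hypothesis nu_kernel : forall a b, nu *m Rm a b = 0.
Hypothesis flat : forall a b, <[nu, a]> = 0 -> <[nu, b]> = 0 -> Rm a b = 0.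

Let ip := (bformDl, bformDr, bformZl, bformZr, bform0l, bform0r,
  frame_nunu fr, frame_nu1 fr, frame_nu2 fr, frame_numu fr,
  frame_11 fr, frame_12 fr, frame_1mu fr, frame_22 fr, frame_2mu fr,
  frame_mumu fr, bformC e1 nu Ssym, bformC e2 nu Ssym, bformC mu nu Ssym,
  bformC e2 e1 Ssym, bformC mu e1 Ssym, bformC mu e2 Ssym).

Let decomp := frame_decomp Ssym fr.
Let ext := frame_ext Ssym fr.

Let Rskew a b u v : <[u *m Rm a b, v]> = - <[u, v *m Rm a b]>.
Proof. by apply: skew_wrtP; exact: lie_curvature_skew. Qed.

Let self_opp (x : R) : x = - x -> x = 0.
Proof. by move=> /eqP; rewrite -addr_eq0 -mulr2n mulrn_eq0 => /eqP. Qed.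

Let skew_diag (M : 'M[R]_4) u : skew_wrt S M -> <[u *m M, u]> = 0.
Proof.
by move=> sM; apply: self_opp; rewrite {1}(skew_wrtP u u sM) bformC.
Qed.

(** Transversal flatness leaves only R(nu, mu). The first Bianchi identity with a third argument
    orthogonal to [nu] makes it vanish on the complement of [nu], and skewness then makes it vanish
    on [mu]. *)
Lemma wave_curvature_nu b : Rm nu b = 0.
Proof.
have Rvmu : Rm nu mu = 0.
  have perp c : <[nu, c]> = 0 -> c *m Rm nu mu = 0.
    move=> hc; have := bianchi nu mu c.
    by rewrite nu_kernel addr0 (flat hc) ?ip // mulmx0 addr0.
  have Rmu : mu *m Rm nu mu = 0.
    apply: ext; rewrite bform0l.
    - by rewrite Rskew perp ?ip ?oppr0.
    - by rewrite Rskew perp ?ip ?oppr0.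
    - by rewrite Rskew perp ?ip ?oppr0.
    - exact: skew_diag (lie_curvature_skew _ _ Lskew).
  apply/row_matrixP => i; rewrite row0 rowE (decomp (delta_mx 0 i)).
  by rewrite !mulmxDl -!scalemxAl Rmu !perp ?ip // !scaler0 !addr0.
rewrite (decomp b) !lie_curvatureDr !lie_curvatureZr Rvmu.
by rewrite !(@flat nu) ?ip // !scaler0 !addr0.
Qed.

Let Rnu2 b : Rm b nu = 0.
Proof. by rewrite lie_curvatureC wave_curvature_nu oppr0. Qed.

(** This describes the line of [nu] by the metric and the curvature alone, which are constant in the
    coframe. If [u] were not orthogonal to [nu], R(mu, .) would vanish on the complement of [nu],
    and so would R altogether; on that complement the form is semidefinite with radical spanned by
    [nu]. *)
Lemma null_curvature_kernel u : (exists a b, Rm a b != 0) ->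
  <[u, u]> = 0 -> (forall b, Rm u b = 0) -> u = <[u, mu]> *: nu.
Proof.
move=> [a [b Rab]] uu Ru.
have unu : <[u, nu]> = 0.
  have Ri e : <[nu, e]> = 0 -> Rm u e = <[u, nu]> *: Rm mu e.
    move=> he; rewrite [in LHS](decomp u) !lie_curvatureDl !lie_curvatureZl.
    by rewrite (@flat nu) ?(@flat e1) ?(@flat e2) ?ip // !scaler0 !add0r.
  apply/eqP; apply: contraNT Rab => unu.
  have Rmu e : <[nu, e]> = 0 -> Rm mu e = 0.
    move=> /Ri; rewrite Ru => /esym/eqP; rewrite scaler_eq0 (negPf unu) => /eqP.
    exact.
  have Rmumu : Rm mu mu = 0 by rewrite /lie_curvature /lie_bracket !subrr raddf0 subr0.
  have Rm0 e c : <[nu, e]> = 0 -> Rm e c = 0.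
    move=> he; rewrite (decomp c) !lie_curvatureDr !lie_curvatureZr.
    rewrite (lie_curvatureC _ e mu) Rmu // !(@flat e) ?ip //.
    by rewrite oppr0 !scaler0 !addr0.
  apply/eqP; rewrite (decomp a) !lie_curvatureDl !lie_curvatureZl !(Rm0 nu, Rm0 e1, Rm0 e2) ?ip //.
  rewrite (decomp b) !lie_curvatureDr !lie_curvatureZr Rmumu !Rmu ?ip //.
  by rewrite !(scaler0, addr0).
have := uu; rewrite {1 2}(decomp u) unu !ip.
rewrite !(mulr0, mulr1, addr0, add0r, mul0r) => /eqP.
rewrite -!expr2 paddr_eq0 ?sqr_ge0 // !sqrf_eq0 => /andP[/eqP u1 /eqP u2].
by rewrite {1}(decomp u) unu u1 u2 !scale0r !addr0.
Qed.

(** In Brinkmann coordinates this is, up to a constant factor, the transverse Hessian of the wave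
    potential. *)
Let hess a b := <[mu *m Rm mu a, b]>.

Let hessC a b : <[nu, a]> = 0 -> <[nu, b]> = 0 -> hess a b = hess b a.
Proof.
move=> ha hb; have := bianchi mu a b.
rewrite (flat ha hb) mulmx0 addr0 (lie_curvatureC _ b) mulmxN => /eqP.
rewrite subr_eq0 => /eqP E.
by rewrite /hess (Rskew mu a) E -(Rskew mu b).
Qed.

Let RmuE a : mu *m Rm mu a = hess a e1 *: e1 + hess a e2 *: e2.
Proof.
apply: ext; rewrite !ip ?(mulr0, mulr1, addr0, add0r) //.
  by rewrite Rskew nu_kernel bform0r oppr0.
exact: skew_diag (lie_curvature_skew _ _ Lskew).
Qed.

(* A trilinear form symmetric in two arguments and skew in two others vanishes. *)
Let cubic0 (M : 'rV[R]_4 -> 'M[R]_4) e a b :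
  (forall c, skew_wrt S (M c)) ->
  (forall c d, <[nu, c]> = 0 -> <[nu, d]> = 0 -> c *m M d = d *m M c) ->
  <[nu, e]> = 0 -> <[nu, a]> = 0 -> <[nu, b]> = 0 -> <[e *m M a, b]> = 0.
Proof.
move=> Mskew sym he ha hb.
have skew c d f : <[c *m M d, f]> = - <[f *m M d, c]>.
  by rewrite skew_wrtP // bformC.
apply: self_opp.
by rewrite {1}(sym e a) // (skew a e b) (sym b e) // (skew e b a) opprK (sym a b) //
  (skew b a e).
Qed.

(** By the first Bianchi identity and flatness the form is symmetric in [e] and [a], and it is skew
    in [e] and [b]. All of R is thus carried by [hess]. *)
Let Re0 e a b : <[nu, e]> = 0 -> <[nu, a]> = 0 -> <[nu, b]> = 0 ->
  <[e *m Rm mu a, b]> = 0.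
Proof.
apply: cubic0 => [c|c d hc hd]; first exact: lie_curvature_skew.
have := bianchi mu d c.
rewrite (flat hd hc) mulmx0 addr0 (lie_curvatureC _ c) mulmxN => /eqP.
by rewrite subr_eq0 => /eqP.
Qed.

Hypothesis nu_recurrent : forall z, nu *m L z = <[nu *m L z, mu]> *: nu.

Let om z := <[nu *m L z, mu]>.
Let th z := <[e1 *m L z, e2]>.
Let T z a b := <[mu *m dR z mu a, b]>.

Let Lperp z a : <[nu, a]> = 0 -> <[nu, a *m L z]> = 0.
Proof.
move=> ha; rewrite bformC // (skew_wrtP _ _ (Lskew z)) nu_recurrent bformZr.
by rewrite (bformC a nu) // ha mulr0 oppr0.
Qed.

(** Skewness and the recurrence of [nu] leave in [L z] only [om z], [th z] and the components of
    [L z] pairing [mu] with [e1] and [e2]; this lemma and the next two record the rows. *)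
Let Lmu z : mu *m L z = <[mu *m L z, e1]> *: e1 + <[mu *m L z, e2]> *: e2 - om z *: mu.
Proof.
apply: ext; rewrite bformBl !ip ?(mulr0, mulr1, addr0, add0r, subr0) //.
  by rewrite (skew_wrtP _ _ (Lskew z)) bformC.
by rewrite oppr0; exact: skew_diag.
Qed.

Let Le1 z : e1 *m L z = <[e1 *m L z, mu]> *: nu + th z *: e2.
Proof.
apply: ext; rewrite !ip ?(mulr0, mulr1, addr0, add0r, subr0) //.
  by rewrite bformC // Lperp ?ip.
exact: skew_diag.
Qed.

Let Le2 z : e2 *m L z = <[e2 *m L z, mu]> *: nu - th z *: e1.
Proof.
apply: ext; rewrite bformBl !ip ?(mulr0, mulr1, addr0, add0r, subr0) //.
- by rewrite bformC // Lperp ?ip ?oppr0.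
- by rewrite (skew_wrtP _ _ (Lskew z)) bformC.
- by rewrite oppr0; exact: skew_diag.
Qed.

(** Each of the two occurrences of [mu] contributes one [om z], whence the factor 2. The remaining
    components of [mu *m L z] drop out by [Re0] and flatness. *)
Let TE z a b : <[nu, a]> = 0 -> <[nu, b]> = 0 ->
  T z a b = hess a e1 * <[e1 *m L z, b]> + hess a e2 * <[e2 *m L z, b]>
    + 2 * om z * hess a b - hess (a *m L z) b.
Proof.
move=> ha hb; rewrite /T mul_nabla_lie_curvature RmuE.
have E1 : <[mu *m L z *m Rm mu a, b]> = - om z * hess a b.
  rewrite Lmu -scaleNr (mulmxDl (_ + _)) (mulmxDl (_ *: e1)) -!scalemxAl.
  by rewrite !(bformDl, bformZl) (@Re0 e1) ?(@Re0 e2) ?ip // !mulr0 !add0r.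
have E2 : Rm (mu *m L z) a = - om z *: Rm mu a.
  rewrite Lmu -scaleNr !lie_curvatureDl !lie_curvatureZl.
  by rewrite (@flat e1) ?(@flat e2) ?ip // !scaler0 !add0r.
rewrite E2 (mulmxDl (_ *: e1)) -!scalemxAl -scalemxAr !bformBl bformDl !bformZl E1 /hess.
by ring.
Qed.

Let dR_flat z a b : <[nu, a]> = 0 -> <[nu, b]> = 0 -> dR z a b = 0.
Proof.
move=> ha hb; rewrite /nabla_lie_curvature !flat ?Lperp // mul0mx mulmx0.
by rewrite !subrr.
Qed.

Let dR_nu z b : dR z nu b = 0.
Proof.
rewrite /nabla_lie_curvature nu_recurrent lie_curvatureZl !wave_curvature_nu.
by rewrite scaler0 mul0mx mulmx0 !subrr.
Qed.

Let nu_dR z a b : nu *m dR z a b = 0.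
Proof.
rewrite mul_nabla_lie_curvature !nu_kernel nu_recurrent.
by rewrite -scalemxAl nu_kernel scaler0 mul0mx !subrr.
Qed.

Let dRskew z a b u v : <[u *m dR z a b, v]> = - <[u, v *m dR z a b]>.
Proof. by apply: skew_wrtP; exact: nabla_lie_curvature_skew. Qed.

Let dRmumu z : dR z mu mu = 0.
Proof.
apply/matrixP => i j; have := congr1 (fun M : 'M[R]_4 => M i j) (nabla_lie_curvatureC L z mu mu).
by rewrite oppmx_entry zeromx_entry => /self_opp.
Qed.

(* Since nabla R is skew and vanishes on nu and on the plane field nu^perp, it
   is determined by the matrices T z. *)
Let dR_eq0 z : (forall i j, i \in [:: e1; e2] -> j \in [:: e1; e2] -> T z i j = 0) ->
  forall a b, dR z a b = 0.
Proof.
move=> T0.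
have he1 : e1 \in [:: e1; e2] by rewrite inE eqxx.
have he2 : e2 \in [:: e1; e2] by rewrite !inE eqxx orbT.
have dRe e : e \in [:: e1; e2] -> dR z mu e = 0.
  move=> he.
  have dRmu : mu *m dR z mu e = 0.
    apply: ext; rewrite ?bform0l.
    - by rewrite dRskew nu_dR bform0r oppr0.
    - exact: (T0 e e1).
    - exact: (T0 e e2).
    - exact: skew_diag (nabla_lie_curvature_skew _ _ _ Lskew).
  have dRperp c : c \in [:: e1; e2] -> c *m dR z mu e = 0.
    move=> hc; have hnu d : d \in [:: e1; e2] -> <[nu, d]> = 0.
      by rewrite !inE => /orP[] /eqP ->; rewrite ip.
    have hmu d : d \in [:: e1; e2] -> <[c *m dR z mu e, d]> = 0.
      (* The argument of [Re0], with the cyclic identity for nabla R in place of that for R. *)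
      move=> hd; apply: (@cubic0 (dR z mu)) (hnu _ hc) (hnu _ he) (hnu _ hd) => [f|f g hf hg].
        exact: nabla_lie_curvature_skew.
      have := nabla_bianchi1 bianchi z mu g f.
      rewrite (dR_flat z hg hf) mulmx0 addr0 (nabla_lie_curvatureC L z f mu) mulmxN => /eqP.
      by rewrite subr_eq0 => /eqP.
    apply: ext; rewrite ?bform0l.
    - by rewrite dRskew nu_dR bform0r oppr0.
    - exact: hmu.
    - exact: hmu.
    - by rewrite dRskew dRmu bform0r oppr0.
  apply/row_matrixP => i; rewrite row0 rowE (decomp (delta_mx 0 i)).
  rewrite !mulmxDl -!scalemxAl dRmu nu_dR !dRperp //.
  by rewrite !scaler0 !addr0.
have dRZ k a b : dR z a (k *: b) = k *: dR z a b.
  by rewrite nabla_lie_curvatureC nabla_lie_curvatureZl -scalerN -nabla_lie_curvatureC.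
have dRD a b c : dR z a (b + c) = dR z a b + dR z a c.
  by rewrite nabla_lie_curvatureC nabla_lie_curvatureDl opprD -!nabla_lie_curvatureC.
have dRm c : dR z mu c = 0.
  rewrite (decomp c) !dRD !dRZ dRmumu (dRe e1) ?(dRe e2) //.
  by rewrite nabla_lie_curvatureC dR_nu oppr0 !scaler0 !addr0.
have dRperp e c : <[nu, e]> = 0 -> dR z e c = 0.
  move=> he; rewrite (decomp c) !dRD !dRZ (nabla_lie_curvatureC _ _ e mu) dRm.
  by rewrite !(dR_flat z he) ?ip // oppr0 !scaler0 !addr0.
move=> a b; rewrite (decomp a) !nabla_lie_curvatureDl !nabla_lie_curvatureZl dRm.
by rewrite !dRperp ?ip // !scaler0 !addr0.
Qed.

Let traceE (f : {linear 'rV[R]_4 -> 'rV[R]_4}) :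
  \sum_k f (delta_mx 0 k) 0 k = <[f nu, mu]> + <[f e1, e1]> + <[f e2, e2]> + <[f mu, nu]>.
Proof.
have := frame_trace Ssym fr (lin1_mx f); rewrite !mul_rV_lin1 => <-.
by apply: eq_bigr => k _; rewrite mxE.
Qed.

(** In the trace the direction [mu] is paired with [nu], which nabla R annihilates. Only derivatives
    along the complement of [nu] survive, and this gives the implication from plane to harmonic at
    once. *)
Let dRtrace a b c : \sum_k (c *m dR (delta_mx 0 k) a b) 0 k =
  <[c *m dR nu a b, mu]> + <[c *m dR e1 a b, e1]> + <[c *m dR e2 a b, e2]>.
Proof.
pose f z := c *m dR z a b.
have flin : linear f.
  by move=> k u v; rewrite /f nabla_lie_curvature_linear mulmxDr -scalemxAr.
pose fL := GRing.isLinear.Build _ _ _ _ f flin.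
pose F : {linear _ -> _} := HB.pack f fL.
apply: etrans (traceE F) _; rewrite /= /f.
by rewrite [X in _ + X = _]dRskew nu_dR bform0r oppr0 addr0.
Qed.

Lemma plane_to_harmonic :
  (forall z, <[nu, z]> = 0 -> forall a b, dR z a b = 0) ->
  forall a b (c : 'rV[R]_4), \sum_k (c *m dR (delta_mx 0 k) a b) 0 k = 0.
Proof.
move=> plane a b c; rewrite dRtrace.
by rewrite !plane ?ip // !mulmx0 !bform0l !addr0.
Qed.

Let hessL1 z b : hess (e1 *m L z) b = th z * hess e2 b.
Proof.
rewrite /hess Le1 lie_curvatureDr !lie_curvatureZr Rnu2 scaler0 add0r.
by rewrite -scalemxAr bformZl.
Qed.

Let hessL2 z b : hess (e2 *m L z) b = - th z * hess e1 b.
Proof.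
rewrite /hess Le2 -scaleNr lie_curvatureDr !lie_curvatureZr Rnu2 scaler0 add0r.
by rewrite -scalemxAr bformZl.
Qed.

Let L11 z : <[e1 *m L z, e1]> = 0. Proof. exact: skew_diag. Qed.
Let L22 z : <[e2 *m L z, e2]> = 0. Proof. exact: skew_diag. Qed.
Let L21 z : <[e2 *m L z, e1]> = - th z.
Proof. by rewrite (skew_wrtP _ _ (Lskew z)) bformC. Qed.

Let h21 : hess e2 e1 = hess e1 e2. Proof. by rewrite hessC ?ip. Qed.

Let T11 z : T z e1 e1 = 2 * om z * hess e1 e1 - 2 * th z * hess e1 e2.
Proof. by rewrite TE ?ip // hessL1 L11 L21 h21;
  move: (om z) (th z) (hess e1 e1) (hess e1 e2) (hess e2 e2) => *; ring. Qed.

Let T12 z : T z e1 e2 = 2 * om z * hess e1 e2 + th z * (hess e1 e1 - hess e2 e2).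
Proof. by rewrite TE ?ip // hessL1 L22 -/(th z);
  move: (om z) (th z) (hess e1 e1) (hess e1 e2) (hess e2 e2) => *; ring. Qed.

Let T21 z : T z e2 e1 = 2 * om z * hess e1 e2 + th z * (hess e1 e1 - hess e2 e2).
Proof. by rewrite TE ?ip // hessL2 L11 L21 h21;
  move: (om z) (th z) (hess e1 e1) (hess e1 e2) (hess e2 e2) => *; ring. Qed.

Let T22 z : T z e2 e2 = 2 * om z * hess e2 e2 + 2 * th z * hess e1 e2.
Proof. by rewrite TE ?ip // hessL2 L22 -/(th z) h21;
  move: (om z) (th z) (hess e1 e1) (hess e1 e2) (hess e2 e2) => *; ring. Qed.

(** The second Bianchi identity for [e1], [e2], [mu]; its third term vanishes by flatness. *)
Let T_bianchi b : T e1 e2 b = T e2 e1 b.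
Proof.
have := bianchi2 bianchi e1 e2 mu; rewrite (dR_flat mu (frame_nu1 fr) (frame_nu2 fr)) addr0.
by rewrite (nabla_lie_curvatureC L e1) addrC => /eqP; rewrite subr_eq0 /T => /eqP ->.
Qed.

(** The second Bianchi identity for [mu], [a], [nu]; the two terms having [nu] as an argument of the
    curvature vanish. *)
Let Tnu a b : T nu a b = 0.
Proof.
rewrite /T; have := bianchi2 bianchi mu a nu.
rewrite (nabla_lie_curvatureC L mu a) !dR_nu oppr0 !add0r => ->.
by rewrite mulmx0 bform0l.
Qed.

(* Flatness of the plane field nu^perp: the rotation rate th is a closed form,
   and the bracket of e1 and e2 is determined by th up to nu. *)
Let th_flat : exists k, k * th nu = th e1 ^+ 2 + th e2 ^+ 2.
Proof.
(* The coefficient of [nu] in the bracket of [e1] and [e2]; the coefficients of [e1] and [e2] are -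
   th(e1) and - th(e2). *)
exists (<[e2 *m L e1, mu]> - <[e1 *m L e2, mu]>).
have thD a b : th (a + b) = th a + th b by rewrite /th raddfD mulmxDr bformDl.
have thZ k a : th (k *: a) = k * th a by rewrite /th linearZ -scalemxAr bformZl.
have E1 : <[e1 *m L e2 *m L e1, e2]> = 0.
  by rewrite Le1 mulmxDl -!scalemxAl bformDl !bformZl nu_recurrent bformZl !ip L22 !mulr0 addr0.
have E2 : <[e1 *m L e1 *m L e2, e2]> = 0.
  by rewrite Le1 mulmxDl -!scalemxAl bformDl !bformZl nu_recurrent bformZl !ip L22 !mulr0 addr0.
(* In R(e1, e2) = 0 paired with [e1] and [e2] the quadratic terms vanish by [E1] and [E2], because
   rotations of a plane commute; the bracket term remains. *)
have E3 : th (lie_bracket L e1 e2) = 0.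
  have := congr1 (fun M => <[e1 *m M, e2]>) (@flat e1 e2 (frame_nu1 fr) (frame_nu2 fr)).
  rewrite /lie_curvature /= mulmx0 bform0l !mulmxBr !mulmxA !bformBl E1 E2.
  by rewrite subr0 sub0r => /eqP; rewrite oppr_eq0 => /eqP.
have thN a : th (- a) = - th a by rewrite -scaleN1r thZ mulN1r.
rewrite /lie_bracket Le1 Le2 !(thD, thN, thZ) in E3.
apply/eqP; rewrite -subr_eq0 -E3; apply/eqP.
by move: (th e1) (th e2) (th nu) <[_, _]> <[_, _]> => *; ring.
Qed.

Lemma harmonic_to_plane :
  (forall a b (c : 'rV[R]_4), \sum_k (c *m dR (delta_mx 0 k) a b) 0 k = 0) ->
  forall z, <[nu, z]> = 0 -> forall a b, dR z a b = 0.
Proof.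
move=> harm.
have dmu z a : <[mu *m dR z mu a, mu]> = 0.
  by apply: skew_diag; exact: nabla_lie_curvature_skew.
have zadd (x y w : R) : x = 0 -> x + y + w = 0 -> y + w = 0 by move=> ->; rewrite add0r.
(* The divergence is evaluated on [mu], e_j, [mu], where the term of direction [nu] is zero by
   skewness. *)
have harm1 : T e1 e1 e1 + T e2 e1 e2 = 0.
  exact: zadd (dmu nu e1) (etrans (esym (dRtrace mu e1 mu)) (harm mu e1 mu)).
have harm2 : T e1 e2 e1 + T e2 e2 e2 = 0.
  exact: zadd (dmu nu e2) (etrans (esym (dRtrace mu e2 mu)) (harm mu e2 mu)).
have [k F] := th_flat.
have C1 := T_bianchi e1; have C2 := T_bianchi e2.
have N1 := Tnu e1 e1; have N2 := Tnu e1 e2.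
rewrite T11 T12 in harm1; rewrite T21 T22 in harm2.
rewrite T21 T11 in C1; rewrite T22 T12 in C2; rewrite T11 in N1; rewrite T12 in N2.
have [E1 E2 E3 [E4 E5 E6]] := wave_equations harm1 harm2 C1 C2 N1 N2 F.
have dRnu a b : dR nu a b = 0 by apply: dR_eq0 => i j _ _; exact: Tnu.
have dR1 a b : dR e1 a b = 0.
  by apply: dR_eq0 => i j; rewrite !inE => /orP[] /eqP -> /orP[] /eqP ->;
    rewrite ?T11 ?T12 ?T21 ?T22.
have dR2 a b : dR e2 a b = 0.
  by apply: dR_eq0 => i j; rewrite !inE => /orP[] /eqP -> /orP[] /eqP ->;
    rewrite ?T11 ?T12 ?T21 ?T22.
(* The coefficient of [mu] in [z] is its product with [nu], which is zero, so linearity in [z]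
   reduces to the directions [nu], [e1], [e2]. *)
move=> z hz a b; rewrite (decomp z) -(bformC nu) // hz scale0r addr0.
rewrite -addrA nabla_lie_curvature_linear dRnu scaler0 add0r.
rewrite nabla_lie_curvature_linear dR1 scaler0 add0r.
have dR0 : dR 0 a b = 0.
  have := nabla_lie_curvature_linear L 0 0 (-1) a b.
  by rewrite scaler0 addr0 scaleN1r addNr.
by rewrite -[_ *: e2]addr0 nabla_lie_curvature_linear dR2 scaler0 add0r.
Qed.

End LieWave.

(** * Moving coframes *)

Section Rearrangements.
Context (R : comNzRingType) (m n : nat).
Implicit Types a b c d e f g h p q r s : 'M[R]_(m, n).

(** Cancellation patterns of the curvature computations below, with the matrix products abstracted
    to variables. *)
Lemma curvature_terms a b c d e f g :
  a + (b + c) + (d + e) - (a + (d + f) + (b + g)) = e - g - (f - c).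
Proof. by mxabel. Qed.

Lemma curvature_derivative_terms a b c d p q r s :
  a + b - (c + d) - (p + q - (r + s)) = b - c - (q - r) + (a - d - (p - s)).
Proof. by mxabel. Qed.

Lemma parallel_terms a b c d : a - b - (c - d) = a - c - (b - d).
Proof. by mxabel. Qed.

Lemma nabla_curvature_terms a b c e f g h :
  a + (b + c) + e - (b + f) - (c + g) - (a + h) = e - h - f - g.
Proof. by mxabel. Qed.

Lemma mxtrace_delta (A : 'M[R]_n) : \tr A = \sum_k ((delta_mx 0 k : 'rV[R]_n) *m A) 0 k.
Proof. by apply: eq_bigr => k _; rewrite -rowE mxE. Qed.

End Rearrangements.

(** * Levi-Civita connection and curvature in a moving coframe *)

Section MovingCoframe.
Context (R : realType) (n : nat).
Variables (O : set 'rV[R]_n) (S E F : 'rV[R]_n -> 'M[R]_n) (S0 : 'M[R]_n).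
Variable L : {linear 'rV[R]_n -> 'M[R]_n}.
Hypothesis openO : open O.
Hypothesis FE : forall y, O y -> F y *m E y = 1%:M.
Hypothesis FC2 : Ck 2 O F.
Hypothesis EC1 : Ck 1 O E.
Hypothesis S0sym : S0^T = S0.
Hypothesis S0unit : S0 \in unitmx.
Hypothesis SF : forall y, O y -> S y = F y *m S0 *m (F y)^T.
Hypothesis Lskew : forall a, skew_wrt S0 (L a).
Local Notation Rm := (lie_curvature L).
Local Notation dR := (nabla_lie_curvature L).
Implicit Types x y u v w z : 'rV[R]_n.

(** The vector [u *m F y] lists the frame components of [u], and the rows of [E y] are the frame
    vectors. Thus [B y u v] is the covariant derivative of the constant field [v] along [u], in
    frame components. *)
Let B y u v : 'rV[R]_n := v *m 'D_u F y + v *m F y *m L (u *m F y).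

(* Cartan's first structure equation. *)
Hypothesis torsion_free : forall y u v, O y -> B y u v = B y v u.

Let EF y : O y -> E y *m F y = 1%:M.
Proof. by move=> Oy; apply: mulmx1C; exact: FE. Qed.

Let dF y u : O y -> derivable F y u.
Proof. by move=> Oy; apply: diff_derivable; have [+ _] := FC2; apply. Qed.

Let ddF y u v : O y -> derivable ('D_v F) y u.
Proof.
by move=> Oy; apply: diff_derivable; have [_ /(_ v) [+ _]] := FC2; apply.
Qed.

Let dE y u : O y -> derivable E y u.
Proof. by move=> Oy; apply: diff_derivable; have [+ _] := EC1; apply. Qed.

Let dvF y u v : O y -> derivable (fun y => v *m F y) y u.
Proof. by move=> Oy; apply: derivable_mulmxl; exact: dF. Qed.

Let DvF y u v : O y -> 'D_u (fun y => v *m F y) y = v *m 'D_u F y.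
Proof. by move=> Oy; apply: derive_mulmxl; exact: dF. Qed.

Let dLF y u v : O y -> derivable (fun y => L (v *m F y)) y u.
Proof. by move=> Oy; apply: derivable_linear; exact: dvF. Qed.

Let DLF y u v : O y -> 'D_u (fun y => L (v *m F y)) y = L (v *m 'D_u F y).
Proof. by move=> Oy; rewrite derive_linear; [rewrite DvF|exact: dvF]. Qed.

Let Sunit x : O x -> S x \in unitmx.
Proof.
move=> Ox; rewrite SF // !unitmx_mul S0unit unitmx_tr.
by have [-> _] := mulmx1_unit (FE Ox).
Qed.

Let metric_derive x u v w : O x ->
  'D_u (fun y => bform (S y) v w) x =
  bform S0 (v *m 'D_u F x) (w *m F x) + bform S0 (v *m F x) (w *m 'D_u F x).
Proof.
move=> Ox.
pose G y := v *m F y *m S0 *m (w *m F y)^T.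
have dS y : O y -> derivable (fun y => v *m F y *m S0) y u.
  by move=> Oy; apply: derivable_mulmxr; exact: dvF.
have dT y : O y -> derivable (fun y => (w *m F y)^T) y u.
  by move=> Oy; apply: derivable_trmx; exact: dvF.
have dG : derivable G x u by apply: derivable_mulmx; [exact: dS|exact: dT].
transitivity ('D_u (fun y => G y 0 0) x).
  apply: near_eq_derive; apply: near_open openO Ox _ => y Oy.
  by rewrite SF // -bform_mulmx.
rewrite -derive_mxE // derive_mulmx; [|exact: dS|exact: dT].
rewrite derive_mulmxr ?DvF //; last exact: dvF.
have DT : 'D_u (fun y => (w *m F y)^T) x = (w *m 'D_u F x)^T.
  by rewrite derive_trmx; [rewrite DvF|exact: dvF].
by rewrite DT mxE.
Qed.

Let metric_compatible x u v w : O x ->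
  'D_u (fun y => bform (S y) v w) x =
  bform S0 (B x u v) (w *m F x) + bform S0 (B x u w) (v *m F x).
Proof.
move=> Ox; rewrite metric_derive // /B !bformDl.
rewrite (bformC (v *m F x) (w *m 'D_u F x)) // (skew_wrtP (v *m F x) (w *m F x)) //.
by rewrite (bformC (v *m F x) (_ *m L _)) // addrACA addNr addr0.
Qed.

(** [B] is compatible with the metric because [L] is skew, and it is symmetric by [torsion_free];
    the Koszul formula therefore returns it. *)
Let koszulE x u v w : O x -> koszul S x u v w = bform S0 (B x u v) (w *m F x).
Proof.
move=> Ox; rewrite /koszul !metric_compatible //.
rewrite (torsion_free v u) // (torsion_free w u) // (torsion_free w v) //.
move: (bform _ _ _) (bform _ _ _) (bform _ _ _) => p q r.
by field.
Qed.

Let christoffelE x u v : O x -> christoffel S x u v = B x u v *m E x.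
Proof.
move=> Ox; rewrite /christoffel.
have -> : \row_k koszul S x u v (delta_mx 0 k) = B x u v *m E x *m S x.
  apply/rowP => k; rewrite mxE koszulE // SF // !mulmxA.
  rewrite -[_ *m E x *m F x]mulmxA EF // mulmx1 /bform trmx_mul trmx_delta !mulmxA.
  by rewrite -colE mxE.
by rewrite mulmxK // Sunit.
Qed.

Let nabla_near (X Y : 'rV[R]_n -> 'rV[R]_n) x u : (\near x, X x = Y x) -> nabla S X x u = nabla S Y x u.
Proof.
by move=> XY; rewrite /nabla (near_eq_derive _ XY) (nbhs_singleton XY).
Qed.

Lemma nabla_coframe (X : 'rV[R]_n -> 'rV[R]_n) x u : O x -> derivable X x u ->
  nabla S X x u =
  ('D_u (fun y => X y *m F y) x + X x *m F x *m L (u *m F x)) *m E x.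
Proof.
move=> Ox dX; rewrite /nabla christoffelE // derive_mulmx //; last exact: dF.
by rewrite -addrA (mulmxDl ('D_u X x *m _)) -(mulmxA _ (F x) (E x)) FE // mulmx1.
Qed.

Let nabla_frame (Y : 'rV[R]_n -> 'rV[R]_n) x u : O x -> derivable Y x u ->
  nabla S (fun y => Y y *m E y) x u = ('D_u Y x + Y x *m L (u *m F x)) *m E x.
Proof.
move=> Ox dY.
have dYE : derivable (fun y => Y y *m E y) x u.
  by apply: derivable_mulmx dY _; exact: dE.
apply: etrans (nabla_coframe Ox dYE) _.
have -> : 'D_u (fun y => Y y *m E y *m F y) x = 'D_u Y x.
  apply: near_eq_derive; apply: near_open openO Ox _ => y Oy.
  by rewrite -mulmxA EF // mulmx1.
by rewrite -(mulmxA (Y x)) EF // mulmx1.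
Qed.

Let dB x u v w : O x -> derivable (fun y => B y v w) x u.
Proof.
move=> Ox; apply: derivableD; first by apply: derivable_mulmxl; exact: ddF.
by apply: derivable_mulmx; [exact: dvF|exact: dLF].
Qed.

Let DB x u v w : O x -> 'D_u (fun y => B y v w) x =
  w *m 'D_u ('D_v F) x + (w *m 'D_u F x *m L (v *m F x) + w *m F x *m L (v *m 'D_u F x)).
Proof.
move=> Ox; rewrite deriveD; last 2 first.
- by apply: derivable_mulmxl; exact: ddF.
- by apply: derivable_mulmx; [exact: dvF|exact: dLF].
rewrite derive_mulmxl; last exact: ddF.
by rewrite derive_mulmx ?DvF ?DLF //; [exact: dvF|exact: dLF].
Qed.

(** The Maurer-Cartan equation of the coframe, obtained by rearranging [torsion_free]. *)
Lemma lie_bracket_coframe x u v : O x ->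
  lie_bracket L (u *m F x) (v *m F x) = u *m 'D_v F x - v *m 'D_u F x.
Proof.
move=> Ox; have := torsion_free u v Ox; rewrite /B /lie_bracket.
have gen (a b c d : 'rV[R]_n) : a + c = b + d -> c - d = b - a.
  by move=> E'; apply/eqP; rewrite subr_eq addrAC -E' (addrC a) addrK.
exact: gen.
Qed.

(** The second derivatives of [F] cancel by Schwarz, and the first derivatives combine into a
    bracket by the Maurer-Cartan equation. *)
Lemma curvature_coframe x u v w : O x ->
  curvature S x u v w = w *m F x *m Rm (u *m F x) (v *m F x) *m E x.
Proof.
move=> Ox; rewrite /curvature.
have step a b : nabla S (fun y => christoffel S y b w) x a =
    ('D_a (fun y => B y b w) x + B x b w *m L (a *m F x)) *m E x.
  transitivity (nabla S (fun y => B y b w *m E y) x a); last first.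
    exact: (nabla_frame Ox (@dB x a b w Ox)).
  apply: nabla_near; apply: near_open openO Ox _ => y Oy.
  exact: christoffelE.
rewrite !step !DB // -mulmxBl; congr (_ *m _).
rewrite (schwarz u v openO Ox FC2) /lie_curvature lie_bracket_coframe //.
rewrite (raddfB L) /B (mulmxDl (w *m 'D_v F x)) (mulmxDl (w *m 'D_u F x)).
rewrite (mulmxBr (w *m F x) (_ - _)) (mulmxBr (w *m F x) (L _ *m _)).
rewrite (mulmxBr (w *m F x) (L _)) !mulmxA.
exact: curvature_terms.
Qed.

Let dRm x u v z : O x -> derivable (fun y => Rm (u *m F y) (v *m F y)) x z.
Proof.
move=> Ox; rewrite /lie_curvature /lie_bracket.
have dLL (a b : 'rV[R]_n) : derivable (fun y => L (a *m F y) *m L (b *m F y)) x z.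
  by apply: derivable_mulmx; exact: dLF.
have dFL (a b : 'rV[R]_n) : derivable (fun y => a *m F y *m L (b *m F y)) x z.
  by apply: derivable_mulmx; [exact: dvF|exact: dLF].
apply: derivableB; first exact: derivableB.
by apply: derivable_linear; exact: derivableB.
Qed.

Let DRm x u v z : O x -> 'D_z (fun y => Rm (u *m F y) (v *m F y)) x =
  Rm (u *m 'D_z F x) (v *m F x) + Rm (u *m F x) (v *m 'D_z F x).
Proof.
move=> Ox; rewrite {1}/lie_curvature {1}/lie_bracket.
have dLL (a b : 'rV[R]_n) : derivable (fun y => L (a *m F y) *m L (b *m F y)) x z.
  by apply: derivable_mulmx; exact: dLF.
have dFL (a b : 'rV[R]_n) : derivable (fun y => a *m F y *m L (b *m F y)) x z.
  by apply: derivable_mulmx; [exact: dvF|exact: dLF].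
have DLL (a b : 'rV[R]_n) : 'D_z (fun y => L (a *m F y) *m L (b *m F y)) x =
    L (a *m 'D_z F x) *m L (b *m F x) + L (a *m F x) *m L (b *m 'D_z F x).
  by rewrite derive_mulmx ?DLF //; exact: dLF.
have DFL (a b : 'rV[R]_n) : 'D_z (fun y => a *m F y *m L (b *m F y)) x =
    a *m 'D_z F x *m L (b *m F x) + a *m F x *m L (b *m 'D_z F x).
  by rewrite derive_mulmx ?DvF ?DLF //; [exact: dvF|exact: dLF].
rewrite deriveB; [|exact: derivableB|]; last first.
  by apply: derivable_linear; exact: derivableB.
rewrite deriveB // derive_linear; last exact: derivableB.
rewrite deriveB // !DLL !DFL /lie_curvature /lie_bracket.
by rewrite !(raddfB L, raddfD L); exact: curvature_derivative_terms.
Qed.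

(** The derivatives of [F] cancel against those in the Christoffel corrections, leaving the
    derivation action of [L]. *)
Lemma nabla_curvature_coframe x z u v w : O x ->
  nabla_curvature S x z u v w =
  w *m F x *m dR (z *m F x) (u *m F x) (v *m F x) *m E x.
Proof.
move=> Ox; rewrite /nabla_curvature.
pose Y y : 'rV[R]_n := w *m F y *m Rm (u *m F y) (v *m F y).
have dY : derivable Y x z by apply: derivable_mulmx; [exact: dvF|exact: dRm].
have -> : nabla S (fun y => curvature S y u v w) x z =
    ('D_z Y x + Y x *m L (z *m F x)) *m E x.
  transitivity (nabla S (fun y => Y y *m E y) x z); last exact: (nabla_frame Ox dY).
  apply: nabla_near; apply: near_open openO Ox _ => y Oy.
  exact: curvature_coframe.
rewrite !curvature_coframe // !christoffelE //.
rewrite -!(mulmxA _ (E x) (F x)) EF // !mulmx1 -!mulmxBl; congr (_ *m _).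
have -> : 'D_z Y x = w *m 'D_z F x *m Rm (u *m F x) (v *m F x) + w *m F x *m
    (Rm (u *m 'D_z F x) (v *m F x) + Rm (u *m F x) (v *m 'D_z F x)).
  exact: etrans (derive_mulmx (@dvF x z w Ox) (@dRm x u v z Ox))
    (f_equal2 (fun p q => p *m Rm (u *m F x) (v *m F x) + w *m F x *m q)
      (@DvF x z w Ox) (@DRm x u v z Ox)).
rewrite (mul_nabla_lie_curvature L (w *m F x) (z *m F x) (u *m F x) (v *m F x)).
rewrite /Y /B.
rewrite (lie_curvatureDl L (u *m 'D_z F x)) (lie_curvatureDr L _ (v *m 'D_z F x)).
rewrite (mulmxDr (w *m F x) (Rm (u *m 'D_z F x) _)).
rewrite (mulmxDr (w *m F x) (Rm (u *m 'D_z F x) _)) (mulmxDr (w *m F x) (Rm _ _)).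
rewrite (mulmxDl (w *m 'D_z F x)).
exact: nabla_curvature_terms.
Qed.

Lemma div_curvature_coframe x u v w : O x ->
  div_curvature S x u v w =
  \sum_k (w *m F x *m dR (delta_mx 0 k) (u *m F x) (v *m F x)) 0 k.
Proof.
move=> Ox; rewrite /div_curvature.
pose f a := w *m F x *m dR a (u *m F x) (v *m F x).
have flin : linear f.
  by move=> k a b; rewrite /f nabla_lie_curvature_linear mulmxDr -scalemxAr.
pose fL := GRing.isLinear.Build _ _ _ _ f flin.
pose f' : {linear _ -> _} := HB.pack f fL.
(* The coordinate trace is that of a conjugate by [F x] of the endomorphism written in the frame. *)
transitivity (\tr (F x *m lin1_mx f' *m E x)).
  rewrite mxtrace_delta; apply: eq_bigr => k _; rewrite nabla_curvature_coframe //.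
  by rewrite !mulmxA mul_rV_lin1.
rewrite mxtrace_mulC mulmxA EF // mul1mx.
by apply: eq_bigr => k _; rewrite mxE.
Qed.

(** The identity is transferred from coordinates, where it follows from the symmetry of the
    Christoffel symbols. *)
Lemma lie_bianchi_coframe : O !=set0 -> forall a b c,
  c *m Rm a b + a *m Rm b c + b *m Rm c a = 0.
Proof.
move=> [x Ox] a b c.
have B1 u v w : curvature S x u v w + curvature S x v w u + curvature S x w u v = 0.
  pose N r p q := nabla S (fun y => christoffel S y p q) x r.
  have Nsym r p q : N r p q = N r q p.
    apply: nabla_near; apply: near_open openO Ox _ => y Oy.
    by rewrite !christoffelE // torsion_free.
  have NE p q r : curvature S x p q r = N p q r - N q p r by [].
  rewrite !NE; move: N Nsym {NE} => N Nsym.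
  by rewrite (Nsym u v w) (Nsym v w u) (Nsym w u v) !subrKA subrr.
have cov (c' : 'rV[R]_n) : c' = c' *m E x *m F x by rewrite -mulmxA EF // mulmx1.
have Einj (p : 'rV[R]_n) : p *m E x = 0 -> p = 0.
  by move=> pE; rewrite (cov p) pE mul0mx.
apply: Einj; rewrite !mulmxDl (cov a) (cov b) (cov c) -!curvature_coframe //.
Qed.

(** The second conclusion is the integrability condition of the first: a second differentiation and
    Schwarz produce the curvature. *)
Lemma parallel_coframe (O' : set 'rV[R]_n) (X : 'rV[R]_n -> 'rV[R]_n) x :
  open O' -> O' `<=` O -> O' x -> Ck 2 O' X ->
  (forall y u, O' y -> nabla S X y u = 0) ->
  (forall u, 'D_u (fun y => X y *m F y) x = - (X x *m F x *m L (u *m F x))) /\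
  (forall a b, X x *m F x *m Rm a b = 0).
Proof.
move=> oO' O'O O'x XC2 par.
pose nu y := X y *m F y.
have nuC2 : Ck 2 O' nu by apply: Ck_mulmx => //; exact: Ck_subset FC2.
have Dnu y u : O' y -> 'D_u nu y = - (nu y *m L (u *m F y)).
  move=> O'y; have Oy := O'O _ O'y.
  have dX : derivable X y u by apply: diff_derivable; have [+ _] := XC2; apply.
  have := nabla_coframe Oy dX; rewrite par // => /esym/(congr1 (mulmx^~ (F y))).
  rewrite /= mul0mx -(mulmxA _ (E y) (F y)) EF // mulmx1 => /eqP.
  by rewrite addr_eq0 => /eqP.
split=> [u|a b]; first exact: Dnu.
have Ox := O'O _ O'x.
have dnu y u : O' y -> derivable nu y u.
  by move=> O'y; apply: diff_derivable; have [+ _] := nuC2; apply.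
have DDnu u v : 'D_v ('D_u nu) x =
    nu x *m L (v *m F x) *m L (u *m F x) - nu x *m L (u *m 'D_v F x).
  transitivity ('D_v (fun y => - (nu y *m L (u *m F y))) x).
    by apply: near_eq_derive; apply: near_open oO' O'x _ => y; exact: Dnu.
  rewrite deriveN; last by apply: derivable_mulmx; [exact: dnu|exact: dLF].
  rewrite derive_mulmx; [|exact: dnu|exact: dLF].
  by rewrite Dnu // DLF // mulNmx opprD opprK.
have Rnu u v : nu x *m Rm (u *m F x) (v *m F x) = 0.
  have := schwarz u v oO' O'x nuC2; rewrite !DDnu => /eqP.
  rewrite -subr_eq0 => /eqP Z; rewrite -[RHS]Z /lie_curvature lie_bracket_coframe //.
  rewrite (raddfB L) (mulmxBr (nu x) (_ - _)) (mulmxBr (nu x) (L _ *m _)).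
  rewrite (mulmxBr (nu x) (L _)) !mulmxA.
  exact: parallel_terms.
have cov (c : 'rV[R]_n) : c *m E x *m F x = c by rewrite -mulmxA EF // mulmx1.
by have := Rnu (a *m E x) (b *m E x); rewrite !cov.
Qed.

End MovingCoframe.

(** * Left-invariant coframes of Lie groups *)

Section KoszulConnection.
Context (R : realType) (n : nat) (S : 'M[R]_n) (M : {linear 'rV[R]_n -> 'M[R]_n}).
Hypothesis Ssym : S^T = S.
Hypothesis Sunit : S \in unitmx.
Implicit Types a b c d : 'rV[R]_n.

Let brk a b : 'rV[R]_n := b *m M a - a *m M b.
(** The Koszul formula for invariant fields: their inner products are constant, so only the bracket
    terms remain. *)
Let kz a b d : R :=
  2^-1 * (bform S (brk a b) d - bform S b (brk a d) - bform S a (brk b d)).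
Let T a : 'M[R]_n := \matrix_(i, j) kz a (delta_mx 0 i) (delta_mx 0 j).

Let brkC a b : brk a b = - brk b a.
Proof. by rewrite /brk opprB. Qed.

Let brk_linear k a b c : brk (k *: a + b) c = k *: brk a c + brk b c.
Proof.
rewrite /brk linearP mulmxDr mulmxDl -scalemxAl -scalemxAr.
by rewrite scalerBr opprD addrACA.
Qed.

Let brk_linearr k a b c : brk c (k *: a + b) = k *: brk c a + brk c b.
Proof. by rewrite brkC brk_linear opprD -scalerN -!brkC. Qed.

Let Tlinear : linear T.
Proof.
move=> k a b; apply/matrixP => i j; rewrite !mxE /kz !brk_linear.
by rewrite !(bformDl, bformDr, bformZl, bformZr); ring.
Qed.

Let TE a b j : (b *m T a) 0 j = kz a b (delta_mx 0 j).
Proof.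
pose f b : R^o := kz a b (delta_mx 0 j).
have flin : linear f.
  move=> k c d; rewrite /f /kz brk_linear brk_linearr.
  rewrite !(bformDl, bformDr, bformZl, bformZr) /GRing.scale /=.
  by ring.
pose fL := GRing.isLinear.Build _ _ _ _ f flin.
pose f' : {linear _ -> _} := HB.pack f fL.
have -> : kz a b (delta_mx 0 j) = f' b by [].
rewrite [in RHS](row_sum_delta b) linear_sum mxE; apply: eq_bigr => i _.
by rewrite linearZ mxE.
Qed.

(** The form [kz a b d] is skew in [b] and [d], and its antisymmetrization in [a] and [b] is the
    bracket; [L a] is obtained by raising an index with [invmx S]. *)
Lemma koszul_connection : exists L : {linear 'rV[R]_n -> 'M[R]_n},
  (forall a, skew_wrt S (L a)) /\
  (forall a b, b *m L a - a *m L b = b *m M a - a *m M b).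
Proof.
pose l a := T a *m invmx S.
have llin : linear l by move=> k a b; rewrite /l Tlinear mulmxDl -scalemxAl.
pose lL := GRing.isLinear.Build _ _ _ _ l llin.
pose L : {linear _ -> _} := HB.pack l lL.
have LS a : L a *m S = T a by rewrite /= /l mulmxKV.
exists L; split=> a.
  rewrite /skew_wrt LS; have -> : S *m (L a)^T = (T a)^T.
    by have := congr1 trmx (LS a); rewrite (trmx_mul (L a) S) Ssym.
  apply/matrixP => i j; rewrite !mxE /kz (brkC (delta_mx 0 j)) bformNr.
  by rewrite !(bformC (delta_mx 0 _)) //; ring.
move=> b; rewrite -/(brk a b); apply: (can_inj (mulmxK Sunit)).
have -> : (b *m L a - a *m L b) *m S = b *m T a - a *m T b.
  by rewrite (mulmxBl (b *m L a)) -(mulmxA b) -(mulmxA a) !LS.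
apply/rowP => j; rewrite addmx_entry oppmx_entry !TE.
have -> : (brk a b *m S) 0 j = bform S (brk a b) (delta_mx 0 j).
  by rewrite /bform trmx_delta -colE [RHS]mxE.
by rewrite /kz (brkC b a) bformNl; field.
Qed.

End KoszulConnection.

(** * Jacobian matrices acting on row vectors *)

Section Jacobian.
Context (R : realType) (m n : nat).
Implicit Types f : 'rV[R]_m -> 'rV[R]_n.

(* It acts on row vectors: the transpose of the usual Jacobian matrix. *)
Definition jac f (z : 'rV[R]_m) : 'M[R]_(m, n) :=
  \matrix_(k < m) 'D_(delta_mx 0 k) f z.

Lemma mul_jac f z u : differentiable f z -> u *m jac f z = 'D_u f z.
Proof.
move=> df; rewrite [u in RHS]row_sum_delta deriveE // linear_sum mulmx_sum_row.
by apply: eq_bigr => k _; rewrite linearZ rowK deriveE.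
Qed.

Lemma Ck_jac k (A : set 'rV[R]_m) f : open A -> Ck k.+1 A f -> Ck k A (jac f).
Proof.
move=> oA [_ Df]; apply/(Ck_mxP _ _ oA) => i j.
have [+ _] := Ck_mxP k ('D_(delta_mx 0 i) f) oA.
by move=> /(_ (Df _) 0 j); under [X in _ -> Ck _ _ X]eq_fun do rewrite mxE.
Qed.

Lemma mul_derive_jac (A : set 'rV[R]_m) f z u v : open A -> A z -> Ck 2 A f ->
  u *m 'D_v (jac f) z = 'D_v ('D_u f) z.
Proof.
move=> oA Az Cf; have [dJ _] : Ck 1 A (jac f) by exact: Ck_jac.
rewrite -derive_mulmxl; last by apply: diff_derivable; exact: dJ.
apply: near_eq_derive; apply: near_open oA Az _ => y Ay.
by apply: mul_jac; have [+ _] := Cf; apply.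
Qed.

End Jacobian.

(** * Left-invariant vector fields in charts *)

Section LieGroupFrame.
Context (R : realType) (n : nat) (G : groupTopologicalType).
Variables (A : smooth_structure R n G) (hG : lie_group A).
Variables (j0 : idx A) (id_j0 : dom (A j0) 1%g).

Let z0 := fwd (A j0) 1%g.

Let bwd_z0 : bwd (A j0) z0 = 1%g. Proof. exact: fwdK. Qed.

Let img_z0 : img (A j0) z0. Proof. exact: fwd_img. Qed.

(** The right factor is read in the chart around the identity, so for a right factor near the
    identity one chart [i] contains both the left factor and the product. *)
Definition chart_mul (i : idx A) (yz : 'rV[R]_n * 'rV[R]_n) : 'rV[R]_n :=
  fwd (A i) (bwd (A i) yz.1 * bwd (A j0) yz.2)%g.

Let D i : set ('rV[R]_n * 'rV[R]_n) :=
  [set yz | [/\ img (A i) yz.1, img (A j0) yz.2 &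
    dom (A i) (bwd (A i) yz.1 * bwd (A j0) yz.2)%g]].

Let open_D i : open (D i).
Proof.
rewrite openE => p [p1 p2 pm].
have c1 : {for p, continuous (fun yz : 'rV[R]_n * 'rV[R]_n => bwd (A i) yz.1)}.
  by apply: (@continuous_comp _ _ _ fst (bwd (A i))); [exact: cvg_fst|exact: bwd_continuous].
have c2 : {for p, continuous (fun yz : 'rV[R]_n * 'rV[R]_n => bwd (A j0) yz.2)}.
  by apply: (@continuous_comp _ _ _ snd (bwd (A j0))); [exact: cvg_snd|exact: bwd_continuous].
have cm : {for p, continuous (fun yz : 'rV[R]_n * 'rV[R]_n =>
    (bwd (A i) yz.1 * bwd (A j0) yz.2)%g)}.
  apply: (@continuous_comp _ _ _ (fun yz : 'rV[R]_n * 'rV[R]_n => (bwd (A i) yz.1, bwd (A j0) yz.2))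
    (fun ab : G * G => (ab.1 * ab.2)%g)); last by have [mc _ _ _] := hG; apply: mc.
  exact: cvg_pair.
have n1 : \forall yz \near p, img (A i) yz.1.
  by apply: cvg_fst; apply: open_nbhs_nbhs; split => //; exact: img_open.
have n2 : \forall yz \near p, img (A j0) yz.2.
  by apply: cvg_snd; apply: open_nbhs_nbhs; split => //; exact: img_open.
have n3 : \forall yz \near p, dom (A i) (bwd (A i) yz.1 * bwd (A j0) yz.2)%g.
  by apply: cm; apply: open_nbhs_nbhs; split => //; exact: dom_open.
by apply: filterS3 n1 n2 n3 => yz.
Qed.

Let D_z0 i y : img (A i) y -> D i (y, z0).
Proof. by move=> iy; split=> //=; rewrite bwd_z0 mulg1; exact: bwd_dom. Qed.

Let chart_mulz0 i y : img (A i) y -> chart_mul i (y, z0) = y.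
Proof. by move=> iy; rewrite /chart_mul /= bwd_z0 mulg1 bwdK. Qed.

Let smooth_mul i k : Ck k (D i) (chart_mul i).
Proof. by have [_ _ + _] := hG; apply. Qed.

Let D_slice i y z : D i (y, z) -> nbhs z [set w | D i (y, w)].
Proof.
move=> Dz; have : nbhs (y, z) (D i) by apply: open_nbhs_nbhs; split => //; exact: open_D.
move=> [[U V] /= [Uy Vz] UV]; apply: filterS Vz => w Vw.
by apply: UV; split => //; exact: nbhs_singleton.
Qed.

Let open_slice i y : open [set w | D i (y, w)].
Proof. by rewrite openE => z Dz; exact: D_slice. Qed.

(* The rows are the left-invariant vector fields that extend the coordinate
   vectors of the chart j0 at the identity. *)
Definition left_frame i (y : 'rV[R]_n) : 'M[R]_n :=
  jac (fun z => chart_mul i (y, z)) z0.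

Let smooth_slice i y k : Ck k [set w | D i (y, w)] (fun w => chart_mul i (y, w)).
Proof. by apply: Ck_slicer; exact: smooth_mul. Qed.

Let diff_slice i y z : D i (y, z) -> differentiable (fun w => chart_mul i (y, w)) z.
Proof. by move=> Dz; have [+ _] := smooth_slice i y 1; apply. Qed.

(** The frame is a partial derivative in the right factor, taken at the identity and viewed as a
    function of the left one; joint smoothness of the multiplication gives its regularity. *)
Lemma left_frame_smooth i k : Ck k (img (A i)) (left_frame i).
Proof.
have oi : open (img (A i)) by exact: img_open.
apply/(Ck_mxP _ _ oi) => k' l.
have -> : (fun y => left_frame i y k' l) =
    (fun y => 'D_(0, delta_mx 0 k') (chart_mul i) (y, z0) 0 l).
  by apply/funext => y; rewrite mxE derive_slicer.
have [_ /(_ (0, delta_mx 0 k')) CD] := smooth_mul i k.+1.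
have C : Ck k (img (A i)) (fun y => 'D_(0, delta_mx 0 k') (chart_mul i) (y, z0)).
  by apply: Ck_subset (Ck_slicel z0 CD) => y; exact: D_z0.
by have [/(_ C) + _] := Ck_mxP k ('D_(0, delta_mx 0 k') (chart_mul i) \o (pair^~ z0)) oi; apply.
Qed.

Lemma mul_left_frame i y u : img (A i) y ->
  u *m left_frame i y = 'D_u (fun z => chart_mul i (y, z)) z0.
Proof. by move=> iy; rewrite mul_jac //; apply: diff_slice; exact: D_z0. Qed.

(* The law (y z) w = y (z w), differentiated in w at the identity. *)
Let left_frame_translate i y z : img (A i) y -> D i (y, z) ->
  left_frame j0 z *m jac (fun z => chart_mul i (y, z)) z = left_frame i (chart_mul i (y, z)).
Proof.
move=> iy [/= _ jz dyz].
have Djz : D j0 (z, z0) by exact: D_z0.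
pose f w := chart_mul i (y, w); pose h w := chart_mul j0 (z, w).
have hz0 : h z0 = z by exact: chart_mulz0.
have dfz : differentiable f z by apply: diff_slice; split.
have dh : differentiable h z0 by exact: diff_slice.
have comp u : 'D_u (fun w => f (h w)) z0 = 'D_('D_u h z0) f z.
  by rewrite -hz0 in dfz; rewrite (derive_comp u dh dfz) hz0.
have fhE : \forall w \near z0, f (h w) = chart_mul i (f z, w).
  apply: filterS (D_slice Djz) => w [/= _ jw dzw].
  by rewrite /f /h /chart_mul /= !fwdK // mulgA.
have E (u : 'rV[R]_n) : u *m left_frame j0 z *m jac f z = u *m left_frame i (f z).
  apply: etrans (congr1 (mulmx^~ (jac f z)) (mul_left_frame u jz)) _.
  apply: etrans (mul_jac _ dfz) _; apply: etrans (esym (comp u)) _.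
  apply: etrans (near_eq_derive u fhE) _; apply/esym/mul_left_frame.
  exact: fwd_img.
by apply/row_matrixP => k; rewrite !rowE mulmxA E.
Qed.

(** The bracket of two left-invariant fields at [y] is the image of their bracket at the identity
    under left translation by [y]. *)
Lemma left_frame_bracket i y (a b : 'rV[R]_n) : img (A i) y ->
  b *m 'D_(a *m left_frame i y) (left_frame i) y
  - a *m 'D_(b *m left_frame i y) (left_frame i) y =
  (b *m 'D_(a *m left_frame j0 z0) (left_frame j0) z0
  - a *m 'D_(b *m left_frame j0 z0) (left_frame j0) z0) *m
   jac (fun z => chart_mul i (y, z)) z0.
Proof.
move=> iy; pose f z := chart_mul i (y, z).
pose N := [set z | D i (y, z)].
have oN : open N by exact: open_slice.
have Nz0 : N z0 by exact: D_z0.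
have Cf k : Ck k N f by exact: smooth_slice.
have dL k z : img (A k) z -> differentiable (left_frame k) z.
  by move=> kz; have [+ _] := left_frame_smooth k 1; apply.
have [dJ _] : Ck 1 N (jac f) by exact: Ck_jac.
(* The identity [left_frame_translate] is differentiated at the identity, by the product rule on one
   side and the chain rule on the other. *)
have Deriv u : 'D_u (left_frame j0) z0 *m jac f z0 + left_frame j0 z0 *m 'D_u (jac f) z0 =
    'D_(u *m jac f z0) (left_frame i) y.
  rewrite -derive_mulmx; last 2 first.
  - by apply: diff_derivable; exact: dL.
  - by apply: diff_derivable; exact: dJ.
  have -> : 'D_u (fun z => left_frame j0 z *m jac f z) z0 =
      'D_u (fun z => left_frame i (f z)) z0.
    apply: near_eq_derive; apply: near_open oN Nz0 _ => z Nz.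
    exact: left_frame_translate.
  have fz0' : f z0 = y by exact: chart_mulz0.
  rewrite derive_comp ?fz0'; [|exact: diff_slice|exact: dL].
  by rewrite mul_jac //; exact: diff_slice.
have fz0 : f z0 = y by exact: chart_mulz0.
have LJ0 : left_frame j0 z0 *m jac f z0 = left_frame i y.
  by apply: etrans (left_frame_translate iy Nz0) _; congr (left_frame i _).
have LJ (c : 'rV[R]_n) : c *m left_frame i y = c *m left_frame j0 z0 *m jac f z0.
  by rewrite -LJ0 mulmxA.
have Term (c d : 'rV[R]_n) : d *m 'D_(c *m left_frame i y) (left_frame i) y =
    d *m 'D_(c *m left_frame j0 z0) (left_frame j0) z0 *m jac f z0 +
    'D_(c *m left_frame j0 z0) ('D_(d *m left_frame j0 z0) f) z0.
  rewrite LJ; apply: etrans (congr1 (mulmx d) (esym (Deriv _))) _.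
  apply: etrans (mulmxDr d _ _) _; congr (_ + _); first exact: mulmxA.
  by apply: etrans (mulmxA d _ _) _; exact: mul_derive_jac oN Nz0 (Cf 2).
apply: etrans (f_equal2 (fun p q => p - q) (Term a b) (Term b a)) _.
(* The second derivatives of the translation [f] are symmetric and cancel in the bracket. *)
rewrite (schwarz (b *m left_frame j0 z0) _ oN Nz0 (Cf 2)).
have cancel (p q : 'rV[R]_n) (r : 'M[R]_n) (s : 'rV[R]_n) :
    p *m r + s - (q *m r + s) = (p - q) *m r.
  by rewrite mulmxBl opprD addrACA subrr addr0.
exact: cancel.
Qed.

Let left_frame1 : left_frame j0 z0 = 1%:M.
Proof.
apply/row_matrixP => k; rewrite rowE mul_left_frame // row1.
rewrite -[RHS](derive_id z0); apply: near_eq_derive.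
have : \forall z \near z0, img (A j0) z.
  by apply: open_nbhs_nbhs; split => //; exact: img_open.
by apply: filterS => z jz; rewrite /chart_mul /= bwd_z0 mul1g bwdK.
Qed.

(** At the identity the frame is the unit matrix, so its derivative there encodes the structure
    constants. *)
Lemma left_frame_structure : exists M : {linear 'rV[R]_n -> 'M[R]_n},
  forall i y (a b : 'rV[R]_n), img (A i) y ->
  b *m 'D_(a *m left_frame i y) (left_frame i) y
  - a *m 'D_(b *m left_frame i y) (left_frame i) y =
  (b *m M a - a *m M b) *m left_frame i y.
Proof.
pose M a := 'D_a (left_frame j0) z0.
have dL : differentiable (left_frame j0) z0.
  by have [+ _] := left_frame_smooth j0 1; apply.
have Mlin : linear M by move=> k a b; rewrite /M !deriveE // linearP.
pose mL := GRing.isLinear.Build _ _ _ _ M Mlin.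
pose M' : {linear _ -> _} := HB.pack M mL.
exists M' => i y a b iy; have := left_frame_bracket a b iy.
have c1 (c : 'rV[R]_n) : c *m left_frame j0 z0 = c by rewrite left_frame1 mulmx1.
by rewrite (c1 a) (c1 b); apply.
Qed.

(** The frame at [y] is the differential at the identity of the left translation by [y], which is an
    isometry. *)
Lemma left_frame_metric (g : lorentzian_metric A) i y :
  left_invariant g -> img (A i) y ->
  left_frame i y *m g i y *m (left_frame i y)^T = g j0 z0.
Proof.
move=> hg iy; apply/matrixP => k l; rewrite -!bform_delta -bform_mulmx.
have [_ _ dm] := D_z0 iy.
have dLa : differentiable (fun z => chart_mul i (y, z)) z0.
  by apply: diff_slice; exact: D_z0.
have LE u : u *m left_frame i y = 'd (fun z => chart_mul i (y, z)) z0 u.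
  exact: etrans (mul_left_frame u iy) (deriveE u dLa).
apply: etrans (hg (bwd (A i) y) j0 i z0 img_z0 dm _ _).
exact: (f_equal3 (fun p a b => bform (g i p) a b) (esym (chart_mulz0 iy)) (LE _) (LE _)).
Qed.

End LieGroupFrame.

Lemma lorentzian_unitmx (R : realType) n (S : 'M[R]_n) :
  lorentzian_form S -> S \in unitmx.
Proof.
move=> [P Pu PS]; have : P *m S *m P^T \in unitmx.
  rewrite PS unitmxE det_diag unitfE; apply/prodf_neq0 => i _.
  by rewrite mxE; case: ifP => _; rewrite ?oppr_eq0 oner_eq0.
by rewrite !unitmx_mul => /andP[/andP[_ ->]].
Qed.

Lemma left_invariant_coframe (R : realType) n (G : groupTopologicalType)
    (A : smooth_structure R n G) (hG : lie_group A) (g : lorentzian_metric A)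
    (hg : left_invariant g) :
  exists (S0 : 'M[R]_n) (L : {linear 'rV[R]_n -> 'M[R]_n})
    (E F : idx A -> 'rV[R]_n -> 'M[R]_n),
  [/\ S0^T = S0, lorentzian_form S0, forall a, skew_wrt S0 (L a) &
   forall i, [/\ forall k, Ck k (img (A i)) (E i), forall k, Ck k (img (A i)) (F i),
     forall y, img (A i) y -> F i y *m E i y = 1%:M,
     forall y, img (A i) y -> g i y = F i y *m S0 *m (F i y)^T &
     forall y u v, img (A i) y ->
       v *m 'D_u (F i) y + v *m F i y *m L (u *m F i y) =
       u *m 'D_v (F i) y + u *m F i y *m L (v *m F i y)]].
Proof.
have [j0 dj0] := chart_cover A 1%g.
pose z0 := fwd (A j0) 1%g; have jz0 : img (A j0) z0 by exact: fwd_img.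
pose S0 : 'M[R]_n := g j0 z0; pose E := left_frame (A := A) j0.
(* This is the inverse of [E i y], by the constancy of the Gram matrix in the frame; in this form
   its smoothness is that of a product. *)
pose F i y : 'M[R]_n := g i y *m (E i y)^T *m invmx S0.
have S0sym : S0^T = S0 by exact: (Defs.metric_sym g jz0).
have S0lor : lorentzian_form S0 by exact: (metric_lorentzian g jz0).
have S0unit := lorentzian_unitmx S0lor.
have [M HM] := left_frame_structure hG dj0.
have [L [Lskew LM]] := koszul_connection M S0sym S0unit.
have EC i k : Ck k (img (A i)) (E i) by exact: left_frame_smooth.
have oi i : open (img (A i)) by exact: img_open.
have FC i k : Ck k (img (A i)) (F i).
  apply: Ck_mulmx (oi i) (Ck_mulmx (oi i) (metric_smooth g i k) (Ck_trmx (oi i) (EC i k))) _.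
  exact: Ck_cst.
have EF i y : img (A i) y -> E i y *m F i y = 1%:M.
  by move=> iy; rewrite /F !mulmxA left_frame_metric // mulmxV.
have FE i y : img (A i) y -> F i y *m E i y = 1%:M.
  by move=> iy; apply: mulmx1C; exact: EF.
exists S0, L, E, F; split=> // i; split=> // [y|y iy|y u v iy].
- exact: FE.
- have EFT : (E i y)^T *m (F i y)^T = 1%:M.
    by rewrite -(trmx_mul (F i y)) FE // trmx1.
  by rewrite {1}/F mulmxKV // -mulmxA EFT mulmx1.
have dE w : derivable (E i) y w by apply: diff_derivable; have [+ _] := EC i 1; apply.
have dF w : derivable (F i) y w by apply: diff_derivable; have [+ _] := FC i 1; apply.
have DF w : 'D_w (F i) y = - (F i y *m 'D_w (E i) y *m F i y).
  have : 'D_w (fun y => F i y *m E i y) y = 0.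
    rewrite -[RHS](derive_cst (1%:M : 'M[R]_n) y w).
    by apply: near_eq_derive; apply: near_open (oi i) iy _ => y' iy'; exact: FE.
  rewrite derive_mulmx // => /(congr1 (mulmx^~ (F i y))).
  rewrite mul0mx mulmxDl -(mulmxA _ (E i y) (F i y)) EF // mulmx1 => /eqP.
  by rewrite addr_eq0 => /eqP.
(* The structure equations of the frame, at the frame components of [u] and [v], become those of the
   coframe through the derivative [DF] of an inverse matrix. *)
have := HM i y (u *m F i y) (v *m F i y) iy.
have FEc (c : 'rV[R]_n) : c *m F i y *m left_frame j0 i y = c.
  by rewrite -(mulmxA c (F i y)) FE // mulmx1.
have EFc (c : 'rV[R]_n) : c *m left_frame j0 i y *m F i y = c.
  by rewrite -(mulmxA c _ (F i y)) EF // mulmx1.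
rewrite (FEc u) (FEc v) -LM => /(congr1 (mulmx^~ (F i y))) /=; rewrite EFc.
rewrite (mulmxBl (v *m F i y *m _)) => H.
have DFc (c w : 'rV[R]_n) : c *m 'D_w (F i) y =
    - (c *m F i y *m 'D_w (left_frame j0 i) y *m F i y).
  by rewrite DF mulmxN !mulmxA.
have gen (X Y p q : 'rV[R]_n) : X - Y = p - q -> - X + p = - Y + q.
  by move=> XY; rewrite -[p](subrK q) -XY !addrA addNr add0r.
by rewrite (DFc v u) (DFc u v); exact: gen.
Qed.

(** * Left-invariant pp-waves *)

Section LeftInvariantWave.
Context (R : realType) (M : topologicalType).
Variables (A : smooth_structure R 4 M) (g : lorentzian_metric A).
Variables (S : 'M[R]_4) (L : {linear 'rV[R]_4 -> 'M[R]_4}).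
Variables (E F : idx A -> 'rV[R]_4 -> 'M[R]_4).
Hypothesis Ssym : S^T = S.
Hypothesis Slor : lorentzian_form S.
Hypothesis Lskew : forall a, skew_wrt S (L a).
Hypothesis EC : forall i k, Ck k (img (A i)) (E i).
Hypothesis FC : forall i k, Ck k (img (A i)) (F i).
Hypothesis FE : forall i y, img (A i) y -> F i y *m E i y = 1%:M.
Hypothesis SF : forall i y, img (A i) y -> g i y = F i y *m S *m (F i y)^T.
Hypothesis torsion_free : forall i y u v, img (A i) y ->
  v *m 'D_u (F i) y + v *m F i y *m L (u *m F i y) =
  u *m 'D_v (F i) y + u *m F i y *m L (v *m F i y).
Variable U : idx A -> 'rV[R]_4 -> {vspace 'rV[R]_4}.
Hypothesis ppU : pp_wave_along g U.
Local Notation Rm := (lie_curvature L).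
Local Notation dR := (nabla_lie_curvature L).
Local Notation ip := (bform S).

Let Sunit : S \in unitmx. Proof. exact: lorentzian_unitmx. Qed.

Let oi i : open (img (A i)). Proof. exact: img_open. Qed.

Local Ltac coframe_hypotheses := try solve
  [exact: oi | exact: FC | exact: EC | exact: FE | exact: SF | exact: torsion_free | assumption].

Let curvE i x u v w : img (A i) x ->
  curvature (g i) x u v w = w *m F i x *m Rm (u *m F i x) (v *m F i x) *m E i x.
Proof.
move=> ix; apply: (@curvature_coframe R 4 (img (A i)) (g i) (E i) (F i) S L).
all: coframe_hypotheses.
Qed.

Let nabla_curvE i x z u v w : img (A i) x ->
  nabla_curvature (g i) x z u v w =
  w *m F i x *m dR (z *m F i x) (u *m F i x) (v *m F i x) *m E i x.
Proof.
move=> ix; apply: (@nabla_curvature_coframe R 4 (img (A i)) (g i) (E i) (F i) S L).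
all: coframe_hypotheses.
Qed.

Let div_curvE i x u v w : img (A i) x ->
  div_curvature (g i) x u v w =
  \sum_k (w *m F i x *m dR (delta_mx 0 k) (u *m F i x) (v *m F i x)) 0 k.
Proof.
move=> ix; apply: (@div_curvature_coframe R 4 (img (A i)) (g i) (E i) (F i) S L).
all: coframe_hypotheses.
Qed.

Let parallelE i (O : set 'rV[R]_4) (X : 'rV[R]_4 -> 'rV[R]_4) x :
  open O -> O `<=` img (A i) -> O x -> Ck 2 O X ->
  (forall y u, O y -> nabla (g i) X y u = 0) ->
  (forall u, 'D_u (fun y => X y *m F i y) x = - (X x *m F i x *m L (u *m F i x))) /\
  (forall a b, X x *m F i x *m Rm a b = 0).
Proof.
move=> oO OA Ox XC par.
apply: (@parallel_coframe R 4 (img (A i)) (g i) (E i) (F i) S L) oO OA Ox XC par.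
all: coframe_hypotheses.
Qed.

Let EF i x : img (A i) x -> E i x *m F i x = 1%:M.
Proof. by move=> ix; apply: mulmx1C; exact: FE. Qed.

Let EFc i x (c : 'rV[R]_4) : img (A i) x -> c *m E i x *m F i x = c.
Proof. by move=> ix; rewrite -mulmxA EF // mulmx1. Qed.

Let FEc i x (c : 'rV[R]_4) : img (A i) x -> c *m F i x *m E i x = c.
Proof. by move=> ix; rewrite -mulmxA FE // mulmx1. Qed.

Let mulmx_E_eq0 i x (c : 'rV[R]_4) : img (A i) x -> c *m E i x = 0 -> c = 0.
Proof. by move=> ix cE; rewrite -(EFc c ix) cE mul0mx. Qed.

Let bianchi i x : img (A i) x ->
  forall a b c, c *m Rm a b + a *m Rm b c + b *m Rm c a = 0.
Proof.
move=> ix; apply: (@lie_bianchi_coframe R 4 (img (A i)) (g i) (E i) (F i) S L).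
all: coframe_hypotheses.
by exists x.
Qed.

Let g_coframe i x a b : img (A i) x ->
  bform (g i x) a b = ip (a *m F i x) (b *m F i x).
Proof. by move=> ix; rewrite SF // bform_mulmx. Qed.

(** Pairing with [b] and multiplying [c] is a constant matrix, so the projection to a fixed line can
    be differentiated as a product. *)
Let bform_outer (a b c : 'rV[R]_4) : a *m (S *m b^T *m c) = ip a b *: c.
Proof. by rewrite !mulmxA [a *m S *m _]mx11_scalar mul_scalar_mx. Qed.

Let wave_vector i x (nu : 'rV[R]_4) :=
  [/\ nu != 0, ip nu nu = 0, forall a b, nu *m Rm a b = 0,
     forall a b, ip nu a = 0 -> ip nu b = 0 -> Rm a b = 0 &
     (forall v, orthogonal_to g U i x v <-> ip nu (v *m F i x) = 0)].

(** The line [U i y] is spanned by [X y], so orthogonality to [U] is orthogonality to one vector;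
    annihilation by R is the integrability condition of a parallel field. *)
Let parallel_wave_vector i (O : set 'rV[R]_4) X y : local_section U i O X ->
  (forall y, O y -> [/\ X y != 0, bform (g i y) (X y) (X y) = 0 &
    forall u, nabla (g i) X y u = 0]) ->
  O y -> wave_vector i y (X y *m F i y).
Proof.
move=> [oO OA XC XU] Xpar Oy; have iy := OA _ Oy.
have [Xy0 Xnull _] := Xpar y Oy.
have Xpar0 z u : O z -> nabla (g i) X z u = 0 by move=> /Xpar[].
have [_ RmX] := parallelE oO OA Oy (XC 2) Xpar0.
have UE : U i y = <[X y]>%VS.
  apply/esym/eqP; have [dimU _] := pp_line ppU.
  by rewrite eqEdim -memvE XU //= dimU // dim_vline Xy0.
have orthE v : orthogonal_to g U i y v <-> ip (X y *m F i y) (v *m F i y) = 0.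
  rewrite -g_coframe // /orthogonal_to UE; split=> [ov|Xv w /vlineP[k ->]].
    by apply: ov; exact: memv_line.
  by rewrite bformZl Xv mulr0.
split=> //.
- by apply: contra_neq Xy0 => XF0; rewrite -(FEc (X y) iy) XF0 mul0mx.
- by rewrite -g_coframe.
move=> a b na nb.
have oa : orthogonal_to g U i y (a *m E i y) by apply/orthE; rewrite EFc.
have ob : orthogonal_to g U i y (b *m E i y) by apply/orthE; rewrite EFc.
have flat := pp_flat ppU iy oa ob.
apply/row_matrixP => k; rewrite row0 rowE.
have := flat (delta_mx 0 k *m E i y); rewrite curvE // !EFc //.
by move=> /(mulmx_E_eq0 iy).
Qed.

(* The parallel field stays on the line of null vectors annihilated by R, which
   is constant in the coframe; this is where nu becomes recurrent. *)
Let wave_at i x : img (A i) x -> exists nu e1 e2 mu : 'rV[R]_4,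
  [/\ wave_vector i x nu, null_frame S nu e1 e2 mu &
   (exists a b, Rm a b != 0) ->
     forall z, nu *m L z = ip (nu *m L z) mu *: nu].
Proof.
move=> ix; have [N [X [sX Nx Xpar]]] := pp_generated ppU ix.
have wX y : N y -> wave_vector i y (X y *m F i y) by exact: parallel_wave_vector.
have [nu0 nunu nuR nuflat _] := wX x Nx.
have [e1 [e2 [mu fr]]] := null_frame_exists Slor nu0 nunu.
exists (X x *m F i x), e1, e2, mu; split=> // [|Rn0 z]; first exact: wX.
have [oN NA XC XU] := sX.
pose nu y : 'rV[R]_4 := X y *m F i y.
have nuE y : N y -> nu y = nu y *m (S *m mu^T *m nu x).
  move=> Ny; have [_ nn nR nflat _] := wX y Ny.
  (* A frame adapted to [nu y] gives R(nu y, .) = 0; the frame at [x] then places [nu y] on the line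
     of [nu x]. *)
  have [f1 [f2 [m' fr']]] := null_frame_exists Slor (let: And5 p _ _ _ _ := wX y Ny in p) nn.
  have Rnu := wave_curvature_nu Ssym Lskew (bianchi ix) fr' nR nflat.
  by rewrite bform_outer; exact: (null_curvature_kernel Ssym fr nuflat Rn0 nn Rnu).
have Xpar0 y u : N y -> nabla (g i) X y u = 0 by move=> /Xpar[].
have [Dnu _] := parallelE oN NA Nx (XC 2) Xpar0.
have dnu u : derivable nu x u.
  apply: derivable_mulmx; apply: diff_derivable.
    by have [+ _] := XC 1; apply.
  by have [+ _] := FC i 1; apply.
(* Differentiating the fixed-line identity puts the derivative of [nu] on the same line, and
   parallelism makes that derivative - nu L. *)
have DnuE u : 'D_u nu x = 'D_u nu x *m (S *m mu^T *m nu x).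
  rewrite -derive_mulmxr //; apply: near_eq_derive.
  by apply: near_open oN Nx _ => y; exact: nuE.
have := DnuE (z *m E i x); rewrite Dnu EFc // => /eqP.
by rewrite mulNmx eqr_opp bform_outer => /eqP.
Qed.

(** If R = 0 both sides hold trivially; otherwise [nu] is recurrent and the statement is the
    algebraic one at each point. *)
Lemma wave_plane_harmonic :
  (forall i x, img (A i) x -> forall z, orthogonal_to g U i x z ->
    forall u v w, nabla_curvature (g i) x z u v w = 0) <->
  harmonic_curvature g.
Proof.
have [[a [b Rab]]|R0] := pselect (exists a b, Rm a b != 0); last first.
  have Rm0 a b : Rm a b = 0.
    by apply/eqP/negPn/negP => Rab; apply: R0; exists a, b.
  have dR0 z a b : dR z a b = 0.
    by rewrite /nabla_lie_curvature !Rm0 mul0mx mulmx0 !subrr.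
  split=> _ i x ix.
    by move=> u v w; rewrite div_curvE // big1 // => k _; rewrite dR0 mulmx0 mxE.
  by move=> z _ u v w; rewrite nabla_curvE // dR0 mulmx0 mul0mx.
split=> [plane i x ix u v w|harm i x ix z oz u v w].
  have [nu [e1 [e2 [mu [[_ _ nuR nuflat orthE] fr rec]]]]] := wave_at ix.
  rewrite div_curvE //; apply: (plane_to_harmonic Ssym Lskew fr nuR).
  + exact: rec (ex_intro _ a (ex_intro _ b Rab)).
  + move=> z nz c d.
    have oz : orthogonal_to g U i x (z *m E i x) by apply/orthE; rewrite EFc.
    apply/row_matrixP => k; rewrite row0 rowE.
    have := plane i x ix _ oz (c *m E i x) (d *m E i x) (delta_mx 0 k *m E i x).
    by rewrite nabla_curvE // !EFc // => /(mulmx_E_eq0 ix).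
have [nu [e1 [e2 [mu [[_ _ nuR nuflat orthE] fr rec]]]]] := wave_at ix.
rewrite nabla_curvE //.
rewrite (harmonic_to_plane Ssym Lskew (bianchi ix) fr nuR nuflat) ?mulmx0 ?mul0mx //.
- exact: rec (ex_intro _ a (ex_intro _ b Rab)).
- move=> c d e; have := harm i x ix (c *m E i x) (d *m E i x) (e *m E i x).
  by rewrite div_curvE // !EFc.
- exact/orthE.
Qed.

End LeftInvariantWave.

Theorem mainTheorem3 (R : realType) (G : groupTopologicalType)
    (A : smooth_structure R 4 G) (hG : lie_group A)
    (g : lorentzian_metric A) (hg : left_invariant g) (hpp : pp_wave g) :
  plane_wave g <-> harmonic_curvature g.
Proof.
have [S [L [E [F [Ssym Slor Lskew HF]]]]] := left_invariant_coframe hG hg.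
(* The equivalence holds for each [U]: a plane wave comes with its own line field, and in the
   converse the line field of the pp-wave is kept. *)
have key U : pp_wave_along g U ->
    (forall i x, img (A i) x -> forall z, orthogonal_to g U i x z ->
      forall u v w, nabla_curvature (g i) x z u v w = 0) <-> harmonic_curvature g.
  apply: (wave_plane_harmonic Ssym Slor Lskew (E := E) (F := F)).
  - by move=> i; have [] := HF i.
  - by move=> i; have [] := HF i.
  - by move=> i; have [] := HF i.
  - by move=> i; have [] := HF i.
  - by move=> i; have [] := HF i.
split=> [[U [ppU plane]]|harm]; first by apply/(key U ppU).
by have [U ppU] := hpp; exists U; split=> //; apply/(key U ppU).
Qed.
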